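(* Let $\mathcal{T}$ be one of the regular tilings $(4^4)$, $(6^3)$, $(3^6)$ (positioned as in the context), let $\varphi_\alpha(z)=\exp(2\pi i z/\alpha)$ with $\alpha$ admissible for $\mathcal{T}$, and let $\mathcal{S}_\alpha=\{\varphi_\alpha(T) : T\in\mathcal{T}\}$. Let $n=\gcd(L,R)$, where $L$ and $R$ are the integers that determine $\alpha$. Define $g_1(z)=\exp(2\pi i/n)\,z$ and $g_2(z)=\bar z$. (a) If $\alpha$ is not balanced, then $\mathrm{S}(\mathcal{S}_\alpha)=\langle g_1\rangle\cong C_n$. (b) If $\alpha$ is balanced, then $\mathrm{S}(\mathcal{S}_\alpha)=\langle g_1,g_2\rangle\cong D_n$.
   Context: The plane $\mathbb{R}^2$ is identified with $\mathbb{C}$, $\mathbb{C}^*=\mathbb{C}\setminus\{0\}$, $i=\sqrt{-1}$, $\omega=e^{2\pi i/3}$. The regular tilings are positioned as follows, and $\Lambda$ denotes the orbit of $0$ under the group of translations preserving $\mathcal{T}$. $(4^4)$: the regular tiling by unit squares whose set of centers is $\mathbb{Z}[i]$; $\Lambda=\mathbb{Z}[i]$. $(6^3)$: the regular tiling by regular hexagons whose set of centers is $\mathbb{Z}[\omega]$; $\Lambda=\mathbb{Z}[\omega]$. $(3^6)$: the regular tiling by equilateral triangles whose set of vertices is the ideal $P_0=(2+\omega)$ of $\mathbb{Z}[\omega]$ (side length $\sqrt3$); $\Lambda=P_0$. Put $\xi=i$ for $(4^4)$ and $\xi=\omega$ for $(6^3)$ and $(3^6)$. A number $\alpha\in\mathbb{C}^*$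 is admissible for $\mathcal{T}$ if $\alpha\in\Lambda$ and $|\alpha|>\max\{|z_1-z_2| : z_1,z_2\in\partial T,\ T\in\mathcal{T}\}$; this maximum is $\sqrt2$, $2\sqrt3/3$, $\sqrt3$ for $(4^4)$, $(6^3)$, $(3^6)$ respectively. For admissible $\alpha$, $\mathcal{S}_\alpha$ is a tiling of $\mathbb{C}^*$. The integers $L,R$ that determine $\alpha$ are the unique integers with $\alpha=L+Ri$ for $(4^4)$, $\alpha=L+R\omega$ for $(6^3)$, and $\alpha=(L+R\omega)(2+\omega)$ for $(3^6)$. An element of $\mathbb{Z}[\xi]$ is balanced if it and its complex conjugate are associates in $\mathbb{Z}[\xi]$. For a set $X$ of tiles, $\mathrm{S}(X)$ is the group of isometries of the plane mapping $X$ onto itself (i.e. permuting the tiles). $C_n$ is the cyclic group of order $n$ and $D_n$ the dihedral group of order $2n$. *)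

(* Defs.v *)
From HB Require Import structures.
From mathcomp Require Import all_boot all_order all_algebra fingroup.
From mathcomp Require Import complex.
From mathcomp Require Import all_classical all_reals all_analysis.

Set Implicit Arguments.
Unset Strict Implicit.
Unset Printing Implicit Defensive.

Import Order.TTheory GRing.Theory Num.Theory.
Import numFieldNormedType.Exports.

Local Open Scope classical_set_scope.
Local Open Scope complex_scope.
Local Open Scope ring_scope.

Section Isometries.
Variable R : realType.

Definition is_isometry (f : R[i] -> R[i]) : Prop :=
  (forall x y, `|f x - f y| = `|x - y|) /\ (forall y, exists x, f x = y).

Record plane_isometry := Isometry {
  isometry_fun :> R[i] -> R[i];
  isometryP : is_isometry isometry_fun }.

HB.instance Definition _ := gen_eqMixin plane_isometry.
HB.instance Definition _ := gen_choiceMixin plane_isometry.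

Lemma isometry_eq (f g : plane_isometry) : f =1 g -> f = g.
Proof.
case: f g => [f fP] [g gP] /= /funext fg; rewrite fg in fP *.
by congr Isometry; apply: Prop_irrelevance.
Qed.

Lemma isometry_comp_subproof (f g : plane_isometry) : is_isometry (f \o g).
Proof.
case: f g => [f [fd fs]] [g [gd gs]]; split => [x y|y] /=.
  by rewrite fd gd.
by have [x <-] := fs y; have [z <-] := gs x; exists z.
Qed.

Lemma isometry_id_subproof : is_isometry (id : R[i] -> R[i]).
Proof. by split=> // y; exists y. Qed.

Definition isometry_inv_fun (f : plane_isometry) (y : R[i]) : R[i] :=
  projT1 (cid ((isometryP f).2 y)).

Lemma isometry_invK (f : plane_isometry) y : f (isometry_inv_fun f y) = y.
Proof. by rewrite /isometry_inv_fun; case: cid. Qed.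

Lemma isometry_inj (f : plane_isometry) : injective f.
Proof.
move=> x y fxy; apply/eqP; rewrite -subr_eq0 -normr_eq0.
by rewrite -(isometryP f).1 fxy subrr normr0.
Qed.

Lemma isometry_inv_subproof (f : plane_isometry) : is_isometry (isometry_inv_fun f).
Proof.
split=> [x y|y].
  by rewrite -(isometryP f).1 !isometry_invK.
by exists (f y); apply: (@isometry_inj f); rewrite isometry_invK.
Qed.

Definition isometry_mul f g := Isometry (isometry_comp_subproof f g).
Definition isometry_one := Isometry isometry_id_subproof.
Definition isometry_inv f := Isometry (isometry_inv_subproof f).

Lemma isometry_mulA : associative isometry_mul.
Proof. by move=> f g h; apply: isometry_eq. Qed.
Lemma isometry_mul1 : left_id isometry_one isometry_mul.
Proof. by move=> f; apply: isometry_eq. Qed.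
Lemma isometry_1mul : right_id isometry_one isometry_mul.
Proof. by move=> f; apply: isometry_eq. Qed.
Lemma isometry_mulV : left_inverse isometry_one isometry_inv isometry_mul.
Proof.
move=> f; apply: isometry_eq => x /=; apply: (@isometry_inj f).
by rewrite isometry_invK.
Qed.
Lemma isometry_mulrV : right_inverse isometry_one isometry_inv isometry_mul.
Proof. by move=> f; apply: isometry_eq => x /=; rewrite isometry_invK. Qed.

HB.instance Definition _ := isGroup.Build plane_isometry
  isometry_mulA isometry_mul1 isometry_1mul isometry_mulV isometry_mulrV.
End Isometries.

Section Groups.
Variable G : groupType.

Definition is_subgroup (H : set G) : Prop :=
  H 1%g /\ forall x y, H x -> H y -> H (x * y^-1)%g.

Definition subgroup_generated (A : set G) : set G := smallest is_subgroup A.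

(* [H], meant to be a subgroup of [G], is isomorphic to [K]. *)
Definition isomorphic_to (H : set G) (K : groupType) : Prop :=
  exists f : K -> G,
    [/\ {morph f : x y / (x * y)%g}, injective f & range f = H].
End Groups.

(* The additive group Z/nZ for n > 0, including the trivial group for n = 1,  *)
(* which ['Z_n] does not cover.                                               *)
Definition cyclic_group (n : nat) : groupType := 'I_n.-1.+1.

(* The dihedral group of order 2n for n > 0, as the semidirect product of     *)
(* Z/nZ by Z/2Z acting by negation; unlike the library's ['D_(2 * n)], it has *)
(* the right order for n = 1 (and it is the Klein four-group for n = 2).      *)
Definition dihedral_elt (n : nat) : Type := ('I_n.-1.+1 * bool)%type.

Section Dihedral.
Variable n : nat.
Implicit Types x y : dihedral_elt n.

HB.instance Definition _ := Finite.on (dihedral_elt n).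

Definition dihedral_mul x y : dihedral_elt n :=
  ((x.1 + (if x.2 then - y.1 else y.1))%R, x.2 (+) y.2).
Definition dihedral_one : dihedral_elt n := (0%R, false).
Definition dihedral_inv x : dihedral_elt n :=
  ((if x.2 then x.1 else - x.1)%R, x.2).

Lemma dihedral_mulA : associative dihedral_mul.
Proof.
move=> [a []] [b []] [c []]; rewrite /dihedral_mul /=;
  by rewrite ?opprD ?opprK ?addrA.
Qed.
Lemma dihedral_mul1 : left_id dihedral_one dihedral_mul.
Proof. by move=> [a s]; rewrite /dihedral_mul /= add0r. Qed.
Lemma dihedral_mulV : left_inverse dihedral_one dihedral_inv dihedral_mul.
Proof.
by move=> [a []]; rewrite /dihedral_mul /dihedral_one /= ?subrr ?addNr.
Qed.

HB.instance Definition _ := Finite_isGroup.Build (dihedral_elt n)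
  dihedral_mulA dihedral_mul1 dihedral_mulV.
End Dihedral.

Definition dihedral_group (n : nat) : groupType := dihedral_elt n.

Section ComplexPlane.
Variable R : realType.
Local Notation C := R[i].
Implicit Types (z alpha : C) (n : nat).

Definition cexp z : C :=
  (expR (complex.Re z))%:C * (cos (complex.Im z) +i* sin (complex.Im z)).

Definition omega : C := cexp (2 * (pi : R)%:C * 'i / 3).

(* Only the regular algebra [C^o] carries the library's topology. *)
Definition boundary (A : set C) : set C :=
  closure (A : set C^o) `\` interior (A : set C^o).

Definition convex_hull (s : seq C) : set C :=
  [set z | exists w : 'I_(size s) -> R,
    [/\ forall k, 0 <= w k, \sum_k w k = 1 & z = \sum_k (w k)%:C * s`_k]].

(* Z[x] for x a quadratic integer *)
Definition Zadjoin (x : C) : set C :=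
  [set z | exists a b : int, z = a%:~R + b%:~R * x].

Definition associates (S : set C) (x y : C) : Prop :=
  exists u v, [/\ S u, S v, u * v = 1 & y = u * x].

Definition rot_fun n z : C := cexp (2 * (pi : R)%:C * 'i / n%:R) * z.

Lemma norm_cexp z : `|cexp z| = (expR (complex.Re z))%:C.
Proof.
rewrite normrM {2}/Num.norm /= cos2Dsin2 sqrtr1 mulr1.
by rewrite ger0_norm // lecR expR_ge0.
Qed.

Lemma rot_subproof n : is_isometry (rot_fun n).
Proof.
have nc : `|cexp (2 * (pi : R)%:C * 'i / n%:R)| = 1.
  rewrite norm_cexp -[n%:R]/(n%:R : C) -(rmorph_nat (real_complex R) n).
  rewrite -fmorphV -(rmorph_nat (real_complex R) 2) -rmorphM mulrAC -rmorphM.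
  by rewrite /= !(mul0r, mulr0) subrr expR0.
have c0 : cexp (2 * (pi : R)%:C * 'i / n%:R) != 0.
  by rewrite -normr_eq0 nc oner_eq0.
split=> [x y|y]; first by rewrite -mulrBr normrM nc mul1r.
by exists ((cexp (2 * (pi : R)%:C * 'i / n%:R))^-1 * y); rewrite /rot_fun mulVKf.
Qed.

Definition g1 n : plane_isometry R := Isometry (rot_subproof n).

Lemma conj_subproof : is_isometry (@conjc R).
Proof.
split=> [x y|y]; last by exists (conjc y); rewrite conjcK.
by rewrite -rmorphB; case: (x - y) => a b; rewrite /Num.norm /= sqrrN.
Qed.

Definition g2 : plane_isometry R := Isometry conj_subproof.

Definition symmetries (X : set (set C)) : set (plane_isometry R) :=
  [set g | [set g @` A | A in X] = X].
End ComplexPlane.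

Arguments omega {R}.
Arguments g2 {R}.

(* In order: (4^4), (6^3) and (3^6) *)
Inductive regular_tiling := Squares | Hexagons | Triangles.

Section Tilings.
Variable R : realType.
Local Notation C := R[i].
Implicit Types (t : regular_tiling) (alpha : C).

Definition xi t : C := if t is Squares then 'i else omega.

Definition P0 : set C := [set (2 + omega) * z | z in Zadjoin omega].

(* 1 + omega is a primitive sixth root of unity.  The vertices of the square  *)
(* centered at c are c + (1 + i) / 2 * i ^ k; the hexagon centered at c has   *)
(* circumradius 1 / sqrt 3 = |2 + omega| / 3 and a side facing c + 1, so its  *)
(* vertices have arguments pi / 6 + k * pi / 3 seen from c, where             *)
(* arg (2 + omega) = pi / 6.                                                  *)
Definition square (c : C) : set C :=
  convex_hull [seq c + (1 + 'i) / 2 * 'i ^+ k | k <- iota 0 4].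
Definition hexagon (c : C) : set C :=
  convex_hull [seq c + (2 + omega) / 3 * (1 + omega) ^+ k | k <- iota 0 6].
Definition triangle (p : C) (k : nat) : set C :=
  convex_hull [:: p; p + (2 + omega) * (1 + omega) ^+ k;
                     p + (2 + omega) * (1 + omega) ^+ k.+1].

Definition tiles t : set (set C) :=
  match t with
  | Squares => [set square c | c in Zadjoin 'i]
  | Hexagons => [set hexagon c | c in Zadjoin omega]
  | Triangles => [set A | exists p k, P0 p /\ A = triangle p k]
  end.

(* The orbit of 0 under the translations preserving the tiling *)
Definition Lambda t : set C :=
  [set g 0 | g in [set g : plane_isometry R |
    symmetries (tiles t) g /\ exists v, forall z, g z = z + v]].

Definition tile_distances t : set C :=
  [set d | exists A z1 z2,
    [/\ tiles t A, boundary A z1, boundary A z2 & d = `|z1 - z2|]].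

Definition admissible t alpha : Prop :=
  [/\ alpha != 0, Lambda t alpha &
    exists m, [/\ tile_distances t m, ubound (tile_distances t) m &
                  m < `|alpha|]].

Definition lattice_point t (l r : int) : C :=
  (l%:~R + r%:~R * xi t) * (if t is Triangles then 2 + omega else 1).

Definition phi alpha (z : C) : C := cexp (2 * (pi : R)%:C * 'i * z / alpha).

Definition spiral_tiling t alpha : set (set C) :=
  [set phi alpha @` A | A in tiles t].

Definition balanced t alpha : Prop :=
  Zadjoin (xi t) alpha /\ associates (Zadjoin (xi t)) alpha (conjc alpha).
End Tilings.

(* Main.v *)
Require Import Defs.
From HB Require Import structures.
From mathcomp Require Import all_boot all_order all_algebra.
From mathcomp Require Import complex.
From mathcomp Require Import all_classical all_reals all_analysis.
From mathcomp Require Import ring lra zify.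

(* A symmetry g of the spiral tiling fixes 0, because the tiles fill C^* but  *)
(* miss 0, so g is z |-> u z or z |-> u z^* with |u| = 1.  It lifts through   *)
(* phi_alpha to an isometry h of the plane, z |-> z + c or                    *)
(* z |-> - (alpha / alpha^* ) z^* + c, where c is a real multiple of alpha.   *)
(* The tiles are convex and narrower than |alpha|, hence two tiles with the   *)
(* same image under phi_alpha differ by a multiple of alpha, and h permutes   *)
(* the tiles of the regular tiling.  Comparing the centres of the tiles, c    *)
(* lies in the translation lattice, so in (alpha / n) Z, and in the second    *)
(* case alpha / alpha^* is a unit of Z[xi], which is balancedness.            *)

Set Implicit Arguments.
Unset Strict Implicit.
Unset Printing Implicit Defensive.

Import Order.TTheory GRing.Theory Num.Theory.

Local Open Scope classical_set_scope.
Local Open Scope complex_scope.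
Local Open Scope ring_scope.

(** * The complex exponential *)

(** [phi alpha] covers the punctured plane by the plane, with deck group Z alpha. It turns
    translation by v into multiplication by [phi alpha v] ([phiD]), and the reflection in the line i
    R alpha, which is z |-> - (alpha / conj alpha) conj z, into complex conjugation ([conj_phi]). A
    symmetry of the spiral tiling is thus a motion of the plane seen through [phi alpha], and the
    point is that this motion respects the regular tiling.

    The passage between the tilings is [phi_image_eq]: admissibility keeps the diameter of a tile
    below |alpha|, and convex sets that narrow with the same image differ by a deck translation.
    Hence the lift maps tiles to tiles ([lift_preserves_tiles]), and [rigid_motion] reads off its
    arithmetic from the centres of the tiles: its linear part is a unit of Z[xi], its translation
    part a lattice vector.

    Lattice vectors on the line R alpha are multiples of alpha / n ([lattice_line]), which leaves
    only the powers of [g1]; a reflection needs alpha / conj alpha to be a unit, which is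
    balancedness ([balancedE]). Conversely [symmetry_g1] and [symmetry_g2] lift the generators to
    motions preserving the regular tiling. The abstract groups enter through the explicit maps
    [cyclic_map] and [dihedral_map]. *)

Section Exponential.
Variable R : realType.
Local Notation C := R[i].
Implicit Types z w alpha : C.

Lemma mulcE (a b c d : R) :
  (a +i* b) * (c +i* d) = (a * c - b * d) +i* (a * d + b * c).
Proof. by []. Qed.

Lemma cexpD z w : cexp (z + w) = cexp z * cexp w.
Proof.
case: z w => [a b] [c d]; rewrite /cexp /= expRD cosD sinD.
by rewrite !mulcE; congr (_ +i* _); ring.
Qed.

Lemma cexp0 : cexp 0 = 1 :> C.
Proof. by rewrite /cexp /= expR0 cos0 sin0 mul1r. Qed.

Lemma conj_cexp z : conjc (cexp z) = cexp (conjc z).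
Proof.
case: z => a b; rewrite /cexp rmorphM /= cosN sinN.
by congr (_ * _); exact: conjc_real.
Qed.

Lemma cosD2piz (x : R) (k : int) : cos (x + (pi *+ 2) *~ k) = cos x.
Proof.
have nat_period (y : R) (n : nat) : cos (y + (pi *+ 2) *+ n) = cos y.
  by elim: n y => [|n IH] y; rewrite ?mulr0n ?addr0 // mulrS addrA IH cosD2pi.
case: k => n; first by rewrite -pmulrn nat_period.
by rewrite NegzE mulrNz -pmulrn -[LHS](nat_period _ n.+1) -addrA addNr addr0.
Qed.

(** Reduce x to y in [0, 2 pi). The half-angle formula gives sin (y / 2) = 0, and the sine is
    positive on (0, pi), so y = 0. *)
Lemma cos_eq1 (x : R) : cos x = 1 -> exists k : int, x = (pi *+ 2) *~ k.
Proof.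
have pi2 : 0 < pi *+ 2 :> R by rewrite pmulrn_lgt0 ?pi_gt0.
pose k := Num.floor (x / (pi *+ 2)).
move=> cx; exists k; apply/eqP; rewrite -subr_eq0.
set y := x - _.
have cy : cos y = 1 by rewrite /y -mulrNz cosD2piz.
have /andP[y0 y1] : 0 <= y < pi *+ 2.
  have /andP[] := floor_itv (x / (pi *+ 2)).
  rewrite -/k ler_pdivlMr // ltr_pdivrMr // intrD mulrDl mul1r.
  by rewrite mulrzl /y subr_ge0 ltrBlDl => -> ->.
have : sin (y / 2) = 0.
  apply/eqP; rewrite -sqrf_eq0 sin2cos2; apply/eqP.
  have := cos_mulr2n (y / 2); have -> : y / 2 *+ 2 = y by field.
  by rewrite cy => h; lra.
case: ltgtP y0 => // y_gt0 _.
have : 0 < sin (y / 2) by apply: sin_gt0_pi; apply/andP; split; lra.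
by move=> + s0; rewrite s0 ltxx.
Qed.

Lemma twopiE : 2 * pi%:C * 'i = 0 +i* (pi *+ 2) :> C.
Proof.
rewrite -complexiE -(rmorph_nat (real_complex R) 2) -rmorphM /=.
by rewrite mulcE !mulr0 !mulr1 subrr addr0 mulr_natl.
Qed.

Lemma twopi_neq0 : 2 * pi%:C * 'i != 0 :> C.
Proof.
by rewrite twopiE eq_complex negb_and /= orbC mulrn_eq0 /= gt_eqF ?pi_gt0.
Qed.

Lemma twopiM z : 2 * pi%:C * 'i * z =
  (- (pi *+ 2 * complex.Im z)) +i* (pi *+ 2 * complex.Re z).
Proof.
by case: z => a b; rewrite twopiE mulcE !mul0r sub0r add0r.
Qed.

Lemma intrE_complex (k : int) : k%:~R = (k%:~R : R)%:C :> C.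
Proof. exact/esym/(rmorph_int (real_complex R)). Qed.

Lemma cexp_eq1 z : cexp z = 1 <-> exists k : int, z = 2 * pi%:C * 'i * k%:~R.
Proof.
split=> [ez|[k ->]]; last first.
  rewrite intrE_complex twopiM /cexp /= mulr0 oppr0 expR0 mul1r.
  rewrite mulrzr -[_ *~ k]add0r cosD2piz cos0.
  have : sin (0 + (pi *+ 2) *~ k) ^+ 2 = 0 :> R.
    by rewrite sin2cos2 cosD2piz cos0 expr1n subrr.
  by move/eqP; rewrite sqrf_eq0 => /eqP ->.
have /= := norm_cexp z; rewrite ez normr1 => /complexI/esym.
have : 1 = complex.Re (cexp z) by rewrite ez.
case: z {ez} => a b /= + e1; rewrite e1 mul1r !mul0r subr0.
move=> /esym/cos_eq1[k bE]; exists k; rewrite intrE_complex twopiM /= mulr0 oppr0.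
congr (_ +i* _); last by rewrite bE mulrzr.
by apply: expR_inj; rewrite expR0.
Qed.

(** Polar coordinates: [acos] yields an angle with the right cosine, and its sign is then chosen to
    match the sine. *)
Lemma cexp_surj w : w != 0 -> exists z, cexp z = w.
Proof.
move=> w0; pose r := Num.sqrt (complex.Re w ^+ 2 + complex.Im w ^+ 2).
have nw : `|w| = r%:C by rewrite normc_def.
have r0 : 0 < r by rewrite -ltcR -nw normr_gt0.
have r2 : r ^+ 2 = complex.Re w ^+ 2 + complex.Im w ^+ 2.
  by rewrite sqr_sqrtr // addr_ge0 // sqr_ge0.
pose c := complex.Re w / r; pose s := complex.Im w / r.
have cs : c ^+ 2 + s ^+ 2 = 1.
  by rewrite /c /s !expr_div_n -mulrDl -r2 divff // sqrf_eq0 gt_eqF.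
have [t ct st] : exists2 t : R, cos t = c & sin t = s.
  have c1 : -1 <= c <= 1 by apply/andP; split; nra.
  have ca : cos (acos c) = c by apply: acosK; rewrite in_itv.
  have : sin (acos c) ^+ 2 = s ^+ 2 by rewrite sin2cos2 ca -cs addrC addKr.
  move/eqP; rewrite eqf_sqr => /orP[]/eqP e; first by exists (acos c).
  by exists (- acos c); rewrite ?cosN // sinN e opprK.
exists (ln r +i* t); rewrite /cexp /= lnK ?posrE // ct st.
rewrite mulcE !mul0r subr0 addr0 ![r * _]mulrC /c /s !divfK ?gt_eqF //.
by case: (w).
Qed.

End Exponential.

(** * The covering of the punctured plane by [phi alpha] *)

Section Phi.
Variable R : realType.
Local Notation C := R[i].
Variable alpha : C.
Hypothesis alpha0 : alpha != 0.
Implicit Types x y z w : C.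

Lemma phiD z w : phi alpha (z + w) = phi alpha z * phi alpha w.
Proof. by rewrite /phi mulrDr mulrDl cexpD. Qed.

Lemma phi_neq0 z : phi alpha z != 0.
Proof.
have e : phi alpha z * phi alpha (- z) = 1.
  by rewrite -phiD subrr /phi mulr0 mul0r cexp0.
by apply: contra_eq_neq e => ->; rewrite mul0r eq_sym oner_neq0.
Qed.

Lemma phi_eq1 z : phi alpha z = 1 <-> exists k : int, z = k%:~R * alpha.
Proof.
rewrite /phi cexp_eq1; split=> -[k e]; exists k; last first.
  by rewrite e mulrA mulfK.
apply: (mulfI (twopi_neq0 R)); rewrite mulrA -e divfK //.
Qed.

Lemma phi_eq x y :
  phi alpha x = phi alpha y <-> exists k : int, x = y + k%:~R * alpha.
Proof.
split=> [e|[k ->]].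
  have /phi_eq1[k ke] : phi alpha (x - y) = 1.
    apply: (mulIf (phi_neq0 y)); rewrite -phiD subrK mul1r //.
  by exists k; rewrite -ke addrC subrK.
rewrite phiD [phi _ (_ * _)](proj2 (phi_eq1 _)) ?mulr1 //; by exists k.
Qed.

Lemma phi_surj w : w != 0 -> exists z, phi alpha z = w.
Proof.
move=> /cexp_surj[u <-]; exists (u * alpha / (2 * pi%:C * 'i)).
have ti := twopi_neq0 R.
by congr cexp; rewrite mulrCA [_ / _]mulrAC mulfV // mulr1 mulfK.
Qed.

(** Conjugation fixes the positive real axis, so its lift is the reflection in the line i R alpha,
    which [phi alpha] maps onto that axis. *)
Lemma conj_phi z :
  conjc (phi alpha z) = phi alpha (- (alpha / conjc alpha) * conjc z).
Proof.
have a0 : conjc alpha != 0 by rewrite conjc_eq0.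
have ct : conjc (2 * pi%:C * 'i) = - (2 * pi%:C * 'i) :> C.
  by rewrite twopiE /=; congr (_ +i* _); rewrite oppr0.
rewrite /phi conj_cexp; congr cexp.
transitivity (conjc (2 * pi%:C * 'i) * conjc z / conjc alpha).
  by rewrite -rmorphM -fmorphV -rmorphM.
by rewrite ct; field; apply/andP.
Qed.

(** The modulus of [phi alpha z] is exp (- 2 pi Im (z / alpha)). *)
Lemma norm_phi_eq1 z : `|phi alpha z| = 1 -> exists t : R, z = t%:C * alpha.
Proof.
rewrite /phi norm_cexp -mulrA twopiM /= => /complexI e.
exists (complex.Re (z / alpha)).
have im0 : complex.Im (z / alpha) = 0.
  have := expR_inj (etrans e (esym (expR0 _))) => /eqP.
  by rewrite oppr_eq0 mulf_eq0 mulrn_eq0 /= gt_eqF ?pi_gt0 //= => /eqP.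
rewrite -[LHS](divfK alpha0); congr (_ * _).
by apply/eqP; rewrite eq_complex /= im0 !eqxx.
Qed.

End Phi.

(** * The cube root of unity [omega] *)

Section Eisenstein.
Variable R : realType.
Local Notation C := R[i].
Local Notation w := (omega : C).

Lemma cexpMn (z : C) n : cexp (z *+ n) = cexp z ^+ n.
Proof.
by elim: n => [|n IH]; rewrite ?mulr0n ?cexp0 ?expr0 // mulrS cexpD IH exprS.
Qed.

Lemma omega_expr3 : w ^+ 3 = 1.
Proof.
rewrite /omega -cexpMn; apply/cexp_eq1; exists 1.
by rewrite mulr1; field.
Qed.

Lemma omega_neq1 : w != 1.
Proof.
apply/negP => /eqP /cexp_eq1[k].
rewrite -[_ / 3]/(2 * pi%:C * 'i * 3^-1) => /(mulfI (twopi_neq0 R)) e.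
have : 1 = k%:~R * 3 :> C by rewrite -e mulVf // pnatr_eq0.
have -> : k%:~R * 3 = (k * 3)%:~R :> C by rewrite intrM.
move/(intr_inj (x1 := 1)); lia.
Qed.

Lemma omega_sqr : w ^+ 2 = - 1 - w.
Proof.
have w1 : w - 1 != 0 by rewrite subr_eq0 omega_neq1.
apply: (mulfI w1); apply/eqP; rewrite -subr_eq0; apply/eqP.
transitivity (w ^+ 3 - 1); first by ring.
by rewrite omega_expr3 subrr.
Qed.

Lemma omega_neq0 : w != 0.
Proof.
apply/eqP => e; have := omega_expr3; rewrite e expr0n /= => /eqP.
by rewrite eq_sym oner_eq0.
Qed.

Lemma norm_omega : `|w| = 1.
Proof.
have h : `|w| ^+ 3 = 1 by rewrite -normrX omega_expr3 normr1.
by apply/eqP; rewrite -(@pexpr_eq1 _ _ 3) // h.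
Qed.

Lemma conj_omega : conjc w = - 1 - w.
Proof.
rewrite -omega_sqr; apply: (mulfI omega_neq0).
by rewrite -sqr_normc norm_omega expr1n -exprS omega_expr3.
Qed.

(** A real [omega] would equal its conjugate, which is its square, and so would be 1. *)
Lemma Im_omega_neq0 : complex.Im w != 0.
Proof.
apply/eqP => im0.
have e : conjc w = w.
  by case: w im0 => a b /= ->; congr (_ +i* _); rewrite oppr0.
have := omega_sqr; rewrite -conj_omega e => e2.
have /eqP := omega_neq1; apply; apply: (mulfI omega_neq0).
by rewrite mulr1 -expr2 e2.
Qed.

End Eisenstein.

(** * Convex hulls *)

Section ConvexHull.
Variable R : realType.
Local Notation C := R[i].
Implicit Types (x y z a b : C) (s : seq C).

(** Weights indexed by all naturals do not depend on the type of indices of [s], so the same weights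
    serve for [map f s]. *)
Lemma convex_hullP s z : convex_hull s z <-> exists w : nat -> R,
  [/\ forall k, 0 <= w k, \sum_(0 <= k < size s) w k = 1 &
      z = \sum_(0 <= k < size s) (w k)%:C * s`_k].
Proof.
split=> -[w [w0 w1 ->]]; last first.
  by exists (fun k => w k); split => //; rewrite -?w1 big_mkord.
pose v k := if insub k is Some i then w i else 0.
have vE (i : 'I_(size s)) : v i = w i.
  by rewrite /v insubT //= => ilt; congr w; apply: val_inj.
exists v; split.
- by move=> k; rewrite /v; case: insubP.
- by rewrite big_mkord -w1; apply: eq_bigr => i _.
- by rewrite big_mkord; apply: eq_bigr => i _; rewrite vE.
Qed.

(** The weights on [s] are pushed forward to the positions of the same points in [s']. Hulls thereby
    depend only on the set of points listed, which lets vertices be permuted freely. *)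
Lemma sub_convex_hull s s' : {subset s <= s'} -> convex_hull s `<=` convex_hull s'.
Proof.
move=> ss z [w [w0 w1 ->]].
have idx (k : 'I_(size s)) : (index (nth 0%R s k) s' < size s')%N.
  by rewrite index_mem ss ?mem_nth.
pose f k := Ordinal (idx k).
exists (fun j => \sum_(k | f k == j) w k); split=> [j||].
- by apply: sumr_ge0.
- by rewrite -w1 (partition_big f xpredT).
- rewrite (partition_big f xpredT) //=; apply: eq_bigr => j _.
  rewrite rmorph_sum mulr_suml; apply: eq_bigr => k /eqP <- /=.
  by rewrite nth_index // ss ?mem_nth.
Qed.

Lemma eq_mem_convex_hull s s' : s =i s' -> convex_hull s = convex_hull s'.
Proof.
by move=> ss; apply/seteqP; split; apply: sub_convex_hull => x; rewrite ss.
Qed.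

Lemma mem_convex_hull s x : x \in s -> convex_hull s x.
Proof.
move=> xs; have ilt : (index x s < size s)%N by rewrite index_mem.
pose i := Ordinal ilt; exists (fun k => (k == i)%:R); split.
- by move=> k; rewrite ler0n.
- by rewrite (bigD1 i) //= eqxx big1 ?addr0 // => k /negbTE ->.
- rewrite (bigD1 i) //= eqxx mul1r nth_index // big1 ?addr0 // => k /negbTE ->.
  by rewrite mul0r.
Qed.

Lemma convex_hull_convex s x y (t : R) : 0 <= t <= 1 ->
  convex_hull s x -> convex_hull s y ->
  convex_hull s ((1 - t)%:C * x + t%:C * y).
Proof.
move=> /andP[t0 t1] [v [v0 v1 ->]] [w [w0 w1 ->]].
exists (fun k => (1 - t) * v k + t * w k); split.
- by move=> k; rewrite addr_ge0 ?mulr_ge0 // subr_ge0.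
- by rewrite big_split /= -!mulr_sumr v1 w1 !mulr1 subrK.
- rewrite !mulr_sumr -big_split /=; apply: eq_bigr => k _.
  by rewrite !mulrA -!rmorphM -mulrDl -rmorphD.
Qed.

Lemma convex_hull_convex3 s x y z (u v w : R) :
  0 <= u -> 0 <= v -> 0 <= w -> u + v + w = 1 ->
  convex_hull s x -> convex_hull s y -> convex_hull s z ->
  convex_hull s (u%:C * x + v%:C * y + w%:C * z).
Proof.
move=> u0 v0 w0 e hx hy hz.
have [uv0|uv0] := eqVneq (u + v) 0.
  have [-> ->] : u = 0 /\ v = 0 by split; lra.
  have -> : w = 1 by lra.
  by rewrite !mul0r !add0r mul1r.
have uv : 0 < u + v by rewrite lt0r uv0 addr_ge0.
pose t := v / (u + v).
have t01 : 0 <= t <= 1.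
  apply/andP; split; first by rewrite divr_ge0 // ltW.
  by rewrite ler_pdivrMr // mul1r lerDr.
have e1 : 1 - w = u + v by lra.
have := convex_hull_convex (t := w) _ (convex_hull_convex t01 hx hy) hz.
rewrite w0 /= => /(_ ltac:(lra)); congr convex_hull.
rewrite mulrDr !mulrA -!rmorphM; congr (_%:C * _ + _%:C * _ + _).
  by rewrite e1 /t; field.
by rewrite e1 /t; field.
Qed.

(** The weights are real, so that maps involving conjugation qualify as well as complex linear
    ones. *)
Definition affine (f : C -> C) := forall n (w : nat -> R) (p : nat -> C),
  \sum_(0 <= k < n) w k = 1 ->
  f (\sum_(0 <= k < n) (w k)%:C * p k) = \sum_(0 <= k < n) (w k)%:C * f (p k).

Lemma affine_linear a b : affine (fun z => a * z + b).
Proof.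
move=> n w p w1.
under [RHS]eq_bigr do rewrite mulrDr.
rewrite big_split /= -mulr_suml -rmorph_sum w1 mul1r mulr_sumr.
by congr (_ + _); apply: eq_bigr => k _; rewrite mulrCA.
Qed.

Lemma affine_antilinear a b : affine (fun z => a * conjc z + b).
Proof.
move=> n w p w1; rewrite rmorph_sum -affine_linear //=.
congr (_ * _ + _); apply: eq_bigr => k _; rewrite rmorphM.
by congr (_ * _); exact: conjc_real.
Qed.

Lemma affine_convex_hull f s : affine f ->
  f @` convex_hull s = convex_hull (map f s).
Proof.
move=> fa; apply/seteqP; split=> [_ [z /convex_hullP[w [w0 w1 ->]] <-]|].
  apply/convex_hullP; exists w; rewrite size_map fa //; split=> //.
  by rewrite !big_mkord; apply: eq_bigr => k _; rewrite (nth_map 0).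
move=> z /convex_hullP[w]; rewrite size_map => -[w0 w1 ->].
exists (\sum_(0 <= k < size s) (w k)%:C * s`_k).
  by apply/convex_hullP; exists w.
by rewrite fa // !big_mkord; apply: eq_bigr => k _; rewrite (nth_map 0).
Qed.

Lemma convex_hull_dist s y (d : C) z :
  (forall x, x \in s -> `|x - y| <= d) -> convex_hull s z -> `|z - y| <= d.
Proof.
move=> sd [w [w0 w1 ->]].
have -> : y = \sum_k (w k)%:C * y by rewrite -mulr_suml -rmorph_sum w1 mul1r.
rewrite -sumrB; apply: (le_trans (ler_norm_sum _ _ _)).
have -> : d = \sum_k (w k)%:C * d by rewrite -mulr_suml -rmorph_sum w1 mul1r.
apply: ler_sum => k _; rewrite -mulrBr normrM ger0_norm ?ler0c //.
by rewrite ler_wpM2l ?ler0c // sd // mem_nth.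
Qed.

Lemma farthest_pair s : s != [::] -> exists v1 v2, [/\ v1 \in s, v2 \in s &
  forall x y, x \in s -> y \in s -> `|x - y| <= `|v1 - v2|].
Proof.
move=> s0; have lt0s : (0 < size s)%N by rewrite lt0n size_eq0.
pose i0 := Ordinal lt0s.
pose F (i : 'I_(size s) * 'I_(size s)) := complex.Re `|s`_i.1 - s`_i.2|.
have nE x : `|x| = (complex.Re `|x|)%:C by rewrite normc_def.
case: (@Order.TotalTheory.arg_maxP _ _ _ (i0, i0) xpredT F isT) => -[i j] /= _ m.
exists s`_i, s`_j; split; rewrite ?mem_nth // => x y xs ys.
have xlt : (index x s < size s)%N by rewrite index_mem.
have ylt : (index y s < size s)%N by rewrite index_mem.
have := m (Ordinal xlt, Ordinal ylt) isT; rewrite /F /= !nth_index //.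
by rewrite -lecR -!nE.
Qed.

(* The hull lies in the disk centred at [v1] with [v2] on its circle. *)
Lemma convex_hull_boundary s v1 v2 : v1 \in s -> v2 \in s -> v1 != v2 ->
  (forall x, x \in s -> `|x - v1| <= `|v2 - v1|) ->
  boundary (convex_hull s) v2.
Proof.
move=> v1s v2s v12 far; split; first exact/subset_closure/mem_convex_hull.
rewrite /interior /= => /nbhs_ballP[e /= e0]; rewrite -ball_normE => be.
have d0 : 0 < `|v2 - v1| by rewrite normr_gt0 subr_eq0 eq_sym.
(* Moving [v2] away from [v1] by [e / 2] stays inside the ball around [v2] but leaves the disk. *)
pose t := e / 2 / `|v2 - v1|.
have t0 : 0 < t by rewrite !divr_gt0.
have /be : ball_ Num.norm v2 e (v2 + t * (v2 - v1)).
  rewrite /ball_ /= opprD addNKr normrN normrM gtr0_norm // divfK ?gt_eqF //.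
  by rewrite ltr_pdivrMr // mulr_natr mulr2n ltrDl.
move=> /(convex_hull_dist far).
have -> : v2 + t * (v2 - v1) - v1 = (1 + t) * (v2 - v1) by ring.
rewrite normrM gtr0_norm ?addr_gt0 // ger_pMl // gerDl.
by rewrite lt_geF.
Qed.

(** Admissibility only controls distances between boundary points. The diameter of a hull is
    attained at two of the listed points, and such a farthest pair lies on the boundary. *)
Lemma convex_hull_diameter s (m : C) : 0 <= m ->
  (forall x y, boundary (convex_hull s) x -> boundary (convex_hull s) y ->
    `|x - y| <= m) ->
  forall x y, convex_hull s x -> convex_hull s y -> `|x - y| <= m.
Proof.
move=> m0 bm x y hx hy.
have s0 : s != [::].
  apply/eqP => s0; move: hx; rewrite s0 => -[w [_ + _]].
  by rewrite big_ord0 => /eqP; rewrite eq_sym oner_eq0.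
have [v1 [v2 [v1s v2s far]]] := farthest_pair s0.
have {}far z z' : convex_hull s z -> convex_hull s z' -> `|z - z'| <= `|v1 - v2|.
  move=> hz hz'; apply: (convex_hull_dist _ hz) => u us.
  rewrite distrC; apply: (convex_hull_dist _ hz') => u' us'.
  exact: far.
apply: (le_trans (far _ _ hx hy)).
have [->|v12] := eqVneq v1 v2; first by rewrite subrr normr0.
apply: bm.
  apply: (convex_hull_boundary v2s v1s); first by rewrite eq_sym.
  by move=> u us; apply: far; apply: mem_convex_hull.
apply: (convex_hull_boundary v1s v2s) => // u us.
by rewrite [leRHS]distrC; apply: far; apply: mem_convex_hull.
Qed.

End ConvexHull.

(** * Images of tiles under phi *)

Section Lift.
Variable R : realType.
Local Notation C := R[i].
Implicit Types (x y z alpha m : C) (A B : set C).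

Definition convex_set A := forall x y (t : R), 0 <= t <= 1 ->
  A x -> A y -> A ((1 - t)%:C * x + t%:C * y).

(** Re (x / alpha) is the coordinate of x along alpha, scaled so that translation by alpha adds 1;
    the extent of [A] in this coordinate is at most [d]. *)
Definition width_le alpha (d : R) A := forall x y, A x -> A y ->
  complex.Re (x / alpha) <= complex.Re (y / alpha) + d.

Lemma ReD x y : complex.Re (x + y) = complex.Re x + complex.Re y.
Proof. by case: x y => [a b] [c d]. Qed.

Lemma ReB x y : complex.Re (x - y) = complex.Re x - complex.Re y.
Proof. by case: x y => [a b] [c d]. Qed.

Lemma ReZ (t : R) x : complex.Re (t%:C * x) = t * complex.Re x.
Proof. by case: x => a b; rewrite mulcE /= mul0r subr0. Qed.

Lemma Re_div_int alpha (k : int) : alpha != 0 ->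
  complex.Re (k%:~R * alpha / alpha) = k%:~R.
Proof. by move=> a0; rewrite mulfK // intrE_complex. Qed.

Lemma norm_realE x : `|x| = (complex.Re `|x|)%:C.
Proof. by rewrite normc_def. Qed.

Lemma diameter_width alpha m : alpha != 0 -> 0 <= m -> m < `|alpha| ->
  exists2 d : R, 0 <= d < 1 &
    forall A, (forall x y, A x -> A y -> `|x - y| <= m) -> width_le alpha d A.
Proof.
move=> a0 m0 ma; have na0 : 0 < `|alpha| by rewrite normr_gt0.
have mE : m = (complex.Re m)%:C by rewrite RRe_real // ger0_real.
exists (complex.Re m / complex.Re `|alpha|).
  rewrite mE norm_realE ltcR in ma; rewrite mE ler0c in m0.
  have {}na0 : 0 < complex.Re `|alpha| by rewrite -ltcR -norm_realE.
  apply/andP; split; first by rewrite divr_ge0 // ltW.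
  by rewrite ltr_pdivrMr // mul1r.
move=> A diam x y Ax Ay; rewrite -lerBlDl -ReB -mulrBl.
apply: le_trans (ler_norm _) _; rewrite -lecR rmorphM fmorphV /=.
rewrite -norm_realE -mE ler_pdivlMr //; apply: le_trans (diam _ _ Ax Ay).
have -> : `|x - y| = `|(x - y) / alpha| * `|alpha| by rewrite -normrM divfK.
by rewrite ler_wpM2r ?normr_ge0 // normc_ge_Re.
Qed.

(* The projections of the translates of [B] on the line through [alpha] are  *)
(* separated by gaps, which the connected set [A] cannot cross.              *)
Lemma covered_by_translate alpha (d : R) A B : alpha != 0 -> 0 <= d < 1 ->
  convex_set A -> A !=set0 -> width_le alpha d B ->
  (forall x, A x -> exists k : int, B (x - k%:~R * alpha)) ->
  exists k : int, forall x, A x -> B (x - k%:~R * alpha).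
Proof.
move=> a0 /andP[d0 d1] cA [x0 Ax0] wB cov; have [k0 Bx0] := cov _ Ax0.
exists k0 => x Ax; have [k Bx] := cov _ Ax.
pose p z := complex.Re (z / alpha).
have pB z (j : int) : p (z - j%:~R * alpha) = p z - j%:~R.
  by rewrite /p mulrBl ReB Re_div_int.
pose b := sup (p @` B).
have bub z : B z -> p z <= b.
  move=> Bz; apply: ub_le_sup; last by exists z.
  by exists (p z + d) => _ [y By <-]; exact: wB.
have blb z : B z -> b <= p z + d.
  move=> Bz; apply: ge_sup; first by exists (p z), z.
  by move=> _ [y By <-]; exact: wB.
have no_gap y z (j l : int) : A y -> A z ->
    B (y - j%:~R * alpha) -> B (z - l%:~R * alpha) -> ~ (j < l).
  move=> Ay Az /bub + /blb +; rewrite !pB => hy hz jl.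
  have jl1 : j%:~R + 1 <= l%:~R :> R by rewrite -[1]/(1%:~R) -intrD ler_int lezD1.
  (* Translates of [B] project into the intervals [b - d + i, b + i] for integers i; [t0] is the
     midpoint of the gap above the one with i = j. Convexity of [A] gives a point [q] of [A]
     projecting to [t0], which no translate can cover. *)
  pose t0 := b + j%:~R + (1 - d) / 2.
  have yt : p y < t0 by rewrite /t0; lra.
  have tz : t0 < p z by rewrite /t0; lra.
  pose t := (t0 - p y) / (p z - p y).
  have yz : 0 < p z - p y by lra.
  have t01 : 0 <= t <= 1.
    by rewrite divr_ge0 /=; [rewrite ler_pdivrMr //; lra|lra|lra].
  have [k1] := cov _ (cA _ _ _ t01 Ay Az).
  set q := (1 - t)%:C * y + t%:C * z => Bq.
  have pq : p q = t0.
    rewrite /p mulrDl -!mulrA ReD !ReZ -/(p y) -/(p z).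
    by rewrite /t; field; rewrite gt_eqF.
  have := bub _ Bq; have := blb _ Bq; rewrite pB pq /t0 => h1 h2.
  have jk : j < k1 by rewrite -(ltr_int R); lra.
  have kj : k1 < j + 1 by rewrite -(ltr_int R) intrD; lra.
  by clear -jk kj; lia.
case: (ltgtP k0 k) => [lt|lt|-> //].
  by have := no_gap _ _ _ _ Ax0 Ax Bx0 Bx lt.
by have := no_gap _ _ _ _ Ax Ax0 Bx Bx0 lt.
Qed.

(** Each set lies in a translate of the other, by k alpha and l alpha. So [A] contains a point
    together with its translate by - (k + l) alpha, and as [A] is narrower than alpha, k + l = 0 and
    both inclusions are equalities. *)
Lemma phi_image_eq alpha (d : R) A B : alpha != 0 -> 0 <= d < 1 ->
  convex_set A -> convex_set B -> A !=set0 -> B !=set0 ->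
  width_le alpha d A -> width_le alpha d B ->
  phi alpha @` A = phi alpha @` B ->
  exists k : int, A = [set z + k%:~R * alpha | z in B].
Proof.
move=> a0 d01 cA cB A0 B0 wA wB AB.
have cov A' B' : phi alpha @` A' = phi alpha @` B' ->
    forall x, A' x -> exists k : int, B' (x - k%:~R * alpha).
  move=> e x A'x; have : (phi alpha @` A') (phi alpha x) by exists x.
  rewrite e => -[y B'y /esym/(phi_eq a0)[k ->]]; exists k.
  by rewrite addrK.
have [k kA] := covered_by_translate a0 d01 cA A0 wB (cov _ _ AB).
have [l lB] := covered_by_translate a0 d01 cB B0 wA (cov _ _ (esym AB)).
case: A0 => x Ax; have := lB _ (kA _ Ax).
have /andP[d0 d1] := d01.
have -> : x - k%:~R * alpha - l%:~R * alpha = x - (k + l)%:~R * alpha.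
  by rewrite intrD; ring.
move=> Ax'; have := wA _ _ Ax Ax'; have := wA _ _ Ax' Ax.
rewrite mulrBl ReB Re_div_int // => h1 h2.
have kl1 : (k + l) < 1 by rewrite -(ltr_int R); lra.
have kl2 : -1 < (k + l) by rewrite -(ltr_int R); lra.
have lk : l = - k by lia.
exists k; apply/seteqP; split => [z Az|_ [z Bz <-]].
  by exists (z - k%:~R * alpha); [exact: kA|rewrite subrK].
by have := lB _ Bz; rewrite lk rmorphN mulNr opprK.
Qed.

End Lift.

(** * Plane isometries *)

Section Isometry.
Variable R : realType.
Local Notation C := R[i].
Implicit Types (x y z u : C) (g h : plane_isometry R) (X : set (set C)).

Lemma normc_sqr_eq x y : `|x| = `|y| ->
  complex.Re x ^+ 2 + complex.Im x ^+ 2 = complex.Re y ^+ 2 + complex.Im y ^+ 2.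
Proof. by move=> e; apply: complexI; rewrite !add_Re2_Im2 e. Qed.

(** After division by [g 1] the isometry fixes 0 and 1. Distances to these two points determine the
    real part and the square of the imaginary part; the distance to the image of i makes the sign of
    the imaginary part the same for all points. *)
Lemma isometry_fix0 g : g 0 = 0 -> exists2 u, `|u| = 1 &
  (forall z, g z = u * z) \/ (forall z, g z = u * conjc z).
Proof.
move=> g0; have ng z : `|g z| = `|z|.
  by rewrite -[g z]subr0 -{1}g0 (isometryP g).1 subr0.
exists (g 1); first by rewrite ng normr1.
have u0 : g 1 != 0 by rewrite -normr_eq0 ng normr1 oner_eq0.
pose f z := g z / g 1.
have fE z : g z = g 1 * f z by rewrite /f mulrC divfK.
have fd x y : `|f x - f y| = `|x - y|.
  by rewrite /f -mulrBl normrM normfV ng normr1 invr1 mulr1 (isometryP g).1.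
have f1 : f 1 = 1 by rewrite /f divff.
have f0 : f 0 = 0 by rewrite /f g0 mul0r.
have fRI z : complex.Re (f z) = complex.Re z /\
    complex.Im (f z) ^+ 2 = complex.Im z ^+ 2.
  have := normc_sqr_eq (fd z 0); have := normc_sqr_eq (fd z 1).
  rewrite f0 f1 !subr0; case: (f z) => a b; case: z => c d /=.
  move=> h1 h2; have e : a = c by lra.
  by split => //; move: h2; rewrite e => /addrI.
have [re_i im_i] := fRI 'i%C.
have fi z : complex.Im (f z) = complex.Im (f 'i%C) * complex.Im z.
  have := normc_sqr_eq (fd z 'i%C); have [] := fRI z.
  move: re_i im_i; case: (f 'i%C) => p q; case: (f z) => a b; case: z => c d /=.
  move=> -> q1 -> bd h.
  have qb : q * b = d by nra.
  by rewrite -qb mulrA -expr2 q1 expr1n mul1r.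
have : (complex.Im (f 'i%C) == 1) || (complex.Im (f 'i%C) == -1).
  by rewrite -eqf_sqr im_i /= .
case/orP=> /eqP e; [left|right] => z; rewrite fE; congr (_ * _).
  by apply/eqP; rewrite eq_complex (fRI z).1 fi e mul1r !eqxx.
apply/eqP; rewrite eq_complex (fRI z).1 fi e mulN1r /=.
by case: (z) => a b /=; rewrite !eqxx.
Qed.

Lemma isometry_mulE g h z : (g * h)%g z = g (h z). Proof. by []. Qed.
Lemma isometry_invE g z : (g^-1)%g (g z) = z.
Proof. by rewrite -isometry_mulE mulVg. Qed.
Lemma image_isometryM g h (A : set C) : (g * h)%g @` A = g @` (h @` A).
Proof. by rewrite image_comp. Qed.

Lemma image_isometry1 (A : set C) : (1%g : plane_isometry R) @` A = A.
Proof. exact: image_id. Qed.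

Lemma symmetriesP X g : symmetries X g <->
  (forall A, X A -> X (g @` A)) /\ (forall A, X A -> X ((g^-1)%g @` A)).
Proof.
split=> [gX|[gX giX]].
  have gX' A : X A -> X (g @` A) by move=> XA; rewrite -gX; exists A.
  split=> // A; rewrite -{1}gX => -[B XB <-].
  by rewrite -image_isometryM mulVg image_isometry1.
apply/seteqP; split=> [_ [A XA <-]|A XA]; first exact: gX.
exists ((g^-1)%g @` A); first exact: giX.
by rewrite -image_isometryM mulgV image_isometry1.
Qed.

Lemma symmetries_subgroup X : is_subgroup (symmetries X).
Proof.
split.
  by apply/symmetriesP; rewrite invg1; split => A; rewrite image_isometry1.
move=> g h /symmetriesP[g1 g2] /symmetriesP[h1 h2]; apply/symmetriesP.
rewrite invgM invgK; split=> A XA; rewrite image_isometryM.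
  exact/g1/h2.
exact/h1/g2.
Qed.

End Isometry.

(** * Subgroups and generated subgroups *)

Section SubgroupGenerated.
Variable G : groupType.
Implicit Types (A H : set G).

Lemma subgroup_generated_sub A H : is_subgroup H -> A `<=` H ->
  subgroup_generated A `<=` H.
Proof. by move=> sH AH x; apply; split. Qed.

Lemma sub_subgroup_generated A : A `<=` subgroup_generated A.
Proof. by move=> x Ax H [_ /(_ x Ax)]. Qed.

Lemma subgroup_generated_subgroup A : is_subgroup (subgroup_generated A).
Proof.
split; first by move=> H [[]].
by move=> x y hx hy H AH; apply: AH.1.2; [exact: hx|exact: hy].
Qed.

Lemma subgroupM H x y : is_subgroup H -> H x -> H y -> H (x * y)%g.
Proof.
move=> [H1 HB] Hx Hy; rewrite -[y]invgK; apply: (HB) => //.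
by rewrite -[(y^-1)%g]mul1g; apply: HB.
Qed.

Lemma subgroupX H x n : is_subgroup H -> H x -> H (x ^+ n)%g.
Proof.
move=> sH Hx; elim: n => [|n IH]; first by rewrite expg0; exact: sH.1.
by rewrite expgS; exact: subgroupM.
Qed.

End SubgroupGenerated.

(** * Gaussian and Eisenstein integers *)

Section QuadraticLattice.
Variable R : realType.
Local Notation C := R[i].
Variables (x : C) (s : int).
Hypotheses (x_sqr : x ^+ 2 = - 1 - s%:~R * x) (x_conj : conjc x = - s%:~R - x).
Hypothesis x_im : complex.Im x != 0.
Implicit Types a b : int.

Lemma real_coord_eq0 (a b : R) : a%:C + b%:C * x = 0 -> a = 0 /\ b = 0.
Proof.
case: x x_im => p q /= q0 /eqP; rewrite mulcE eq_complex /= !mul0r subr0 addr0 add0r.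
move=> /andP[+ /eqP/eqP]; rewrite mulf_eq0 (negbTE q0) orbF => + /eqP b0.
by rewrite b0 mul0r addr0 => /eqP.
Qed.

Lemma real_coord (z : C) : exists a b : R, z = a%:C + b%:C * x.
Proof.
case: x x_im => p q /= q0; case: z => c d.
exists (c - d / q * p), (d / q); rewrite mulcE !mul0r subr0 addr0.
by congr (_ +i* _); rewrite ?subrK // add0r divfK.
Qed.

Lemma int_coord_inj a b a' b' :
  a%:~R + b%:~R * x = a'%:~R + b'%:~R * x -> a = a' /\ b = b'.
Proof.
move=> e.
have /real_coord_eq0[] : ((a - a')%:~R : R)%:C + ((b - b')%:~R : R)%:C * x = 0.
  rewrite -!intrE_complex !rmorphB /= mulrBl addrACA -opprD.
  by apply/eqP; rewrite subr_eq0 e.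
move=> /eqP; rewrite intr_eq0 subr_eq0 => /eqP -> /eqP.
by rewrite intr_eq0 subr_eq0 => /eqP ->.
Qed.

Lemma Zadjoin_int a : Zadjoin x a%:~R.
Proof. by exists a, 0; rewrite mul0r addr0. Qed.

Lemma Zadjoin_gen : Zadjoin x x.
Proof. by exists 0, 1; rewrite add0r mul1r. Qed.

Lemma ZadjoinD u v : Zadjoin x u -> Zadjoin x v -> Zadjoin x (u + v).
Proof.
move=> [a [b ->]] [c [d ->]]; exists (a + c), (b + d).
by rewrite !intrD mulrDl addrACA.
Qed.

Lemma ZadjoinN u : Zadjoin x u -> Zadjoin x (- u).
Proof.
by move=> [a [b ->]]; exists (- a), (- b); rewrite !rmorphN mulNr opprD.
Qed.

Lemma ZadjoinB u v : Zadjoin x u -> Zadjoin x v -> Zadjoin x (u - v).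
Proof. by move=> hu /ZadjoinN; exact: ZadjoinD. Qed.

Lemma ZadjoinM u v : Zadjoin x u -> Zadjoin x v -> Zadjoin x (u * v).
Proof.
move=> [a [b ->]] [c [d ->]]; exists (a * c - b * d), (a * d + b * c - s * b * d).
rewrite !(intrD, rmorphN, intrM) /=.
transitivity (a%:~R * c%:~R + (a%:~R * d%:~R + b%:~R * c%:~R) * x
   + b%:~R * d%:~R * x ^+ 2); first by ring.
by rewrite x_sqr; ring.
Qed.

Lemma conj_intr a : conjc (a%:~R : C) = a%:~R.
Proof. exact: rmorph_int. Qed.

Lemma Zadjoin_conj u : Zadjoin x u -> Zadjoin x (conjc u).
Proof.
move=> [a [b ->]]; rewrite rmorphD rmorphM /= x_conj !conj_intr.
exists (a - s * b), (- b); rewrite !(intrD, rmorphN, intrM) /=; ring.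
Qed.

(** The right-hand side is the norm form of Z[x]. *)
Lemma norm_int_coord a b :
  `|a%:~R + b%:~R * x| ^+ 2 = (a ^+ 2 - s * a * b + b ^+ 2)%:~R.
Proof.
rewrite sqr_normc rmorphD rmorphM /= x_conj !conj_intr.
rewrite !(intrD, rmorphN, intrM, rmorphXn) /=.
transitivity (a%:~R ^+ 2 - s%:~R * a%:~R * b%:~R
   - b%:~R ^+ 2 * (x ^+ 2 + s%:~R * x) : C); first by ring.
by rewrite x_sqr; ring.
Qed.

Lemma Zadjoin_norm1 u : Zadjoin x u -> `|u| = 1 ->
  exists a b, u = a%:~R + b%:~R * x /\ a ^+ 2 - s * a * b + b ^+ 2 = 1.
Proof.
move=> [a [b ->]] u1; exists a, b; split=> //.
by have := norm_int_coord a b; rewrite u1 expr1n => /esym/(intr_inj (x2 := 1)).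
Qed.

End QuadraticLattice.

(** * The rings Z[xi] and their units *)

Section Gaussian.
Variable R : realType.
Local Notation C := R[i].

Lemma i_sqr : ('i : C) ^+ 2 = - 1 - 0%:~R * 'i.
Proof. by rewrite mul0r subr0 sqrCi. Qed.

Lemma i_conj : conjc ('i : C) = - 0%:~R - 'i.
Proof.
rewrite -complexiE /= -[0%:~R]/(0 : C) oppr0 sub0r.
by congr (_ +i* _); rewrite oppr0.
Qed.

Lemma i_im : complex.Im ('i : C) != 0.
Proof. by rewrite -complexiE /= oner_eq0. Qed.

Lemma w_sqr : (omega : C) ^+ 2 = - 1 - 1%:~R * omega.
Proof. by rewrite mul1r omega_sqr. Qed.

Lemma w_conj : conjc (omega : C) = - 1%:~R - omega.
Proof. by rewrite conj_omega. Qed.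

(** The coefficient s for which [xi] is a root of X^2 + s X + 1, hence minus the trace of [xi]. *)
Definition trace_xi (t : regular_tiling) : int := if t is Squares then 0 else 1.

Lemma xi_sqr t : (xi R t) ^+ 2 = - 1 - (trace_xi t)%:~R * xi R t.
Proof. by case: t; rewrite /= -?i_sqr -?w_sqr. Qed.

Lemma xi_conj t : conjc (xi R t) = - (trace_xi t)%:~R - xi R t.
Proof. by case: t; [exact: i_conj|exact: w_conj|exact: w_conj]. Qed.

Lemma xi_im t : complex.Im (xi R t) != 0.
Proof. by case: t; rewrite /= ?i_im ?Im_omega_neq0. Qed.

Local Notation zeta := (1 + omega : C).

Lemma zeta_sqr : zeta ^+ 2 = omega.
Proof. by rewrite sqrrD omega_sqr; ring. Qed.

Lemma zeta3 : zeta ^+ 3 = -1.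
Proof. by rewrite exprSr zeta_sqr mulrDr mulr1 -expr2 omega_sqr; ring. Qed.

Lemma zeta6 : zeta ^+ 6 = 1.
Proof. by rewrite (exprM _ 3 2) zeta3 sqrrN expr1n. Qed.

Lemma zeta_conj : conjc zeta = zeta ^+ 5.
Proof.
have -> : conjc zeta = 1 + conjc omega by rewrite rmorphD rmorph1.
rewrite conj_omega (exprD _ 3 2) zeta3 zeta_sqr; ring.
Qed.

Lemma i4 : ('i : C) ^+ 4 = 1.
Proof. by rewrite (exprM _ 2 2) sqrCi sqrrN expr1n. Qed.

Lemma i_conj3 : conjc ('i : C) = 'i ^+ 3.
Proof. by rewrite i_conj exprS sqrCi mulrN1 oppr0 sub0r. Qed.

(** A generator of the unit group of Z[xi], of order 4 or 6. *)
Definition unit_gen t : C := if t is Squares then 'i else zeta.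

(** The norm form is positive definite, so norm 1 confines both coordinates to -1, 0, 1; the four or
    six solutions are matched with powers one by one. *)
Lemma unit_power t u : Zadjoin (xi R t) u -> `|u| = 1 ->
  exists k, u = unit_gen t ^+ k.
Proof.
move=> hu /(Zadjoin_norm1 (@xi_sqr t) (@xi_conj t) hu)[a [b [-> e]]].
have ba : (-1 <= a <= 1) /\ (-1 <= b <= 1) by case: t e {hu} => /=; nia.
have aE : (a == -1) || (a == 0) || (a == 1) by lia.
have bE : (b == -1) || (b == 0) || (b == 1) by lia.
case: t e {hu ba} => /= e.
- have : (a = 1 /\ b = 0) \/ (a = 0 /\ b = 1) \/ (a = -1 /\ b = 0) \/ (a = 0 /\ b = -1).
    by move: aE bE e => /orP[/orP[]|] /eqP -> /orP[/orP[]|] /eqP ->; lia.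
  case=> [[-> ->]|[[-> ->]|[[-> ->]|[-> ->]]]].
  + by exists 0%N; rewrite expr0 mul0r addr0.
  + by exists 1%N; rewrite expr1 add0r mul1r.
  + by exists 2%N; rewrite sqrCi mul0r addr0.
  + by exists 3%N; rewrite exprS sqrCi add0r mulN1r mulrN1.
1-2: have : (a = 1 /\ b = 0) \/ (a = 1 /\ b = 1) \/ (a = 0 /\ b = 1) \/
         (a = -1 /\ b = 0) \/ (a = -1 /\ b = -1) \/ (a = 0 /\ b = -1)
    by move: aE bE e => /orP[/orP[]|] /eqP -> /orP[/orP[]|] /eqP ->; lia.
1-2: case=> [[-> ->]|[[-> ->]|[[-> ->]|[[-> ->]|[[-> ->]|[-> ->]]]]]].
1,7: by exists 0%N; rewrite expr0 mul0r addr0.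
1,6: by exists 1%N; rewrite expr1 mul1r.
1,5: by exists 2%N; rewrite zeta_sqr add0r mul1r.
1,4: by exists 3%N; rewrite zeta3 mul0r addr0.
1,3: by exists 4%N; rewrite (exprD _ 3 1) zeta3 expr1; ring.
1,2: by exists 5%N; rewrite (exprD _ 3 2) zeta3 zeta_sqr add0r.
Qed.

End Gaussian.

(** * Regular polygons *)

Section Polygon.
Variable R : realType.
Local Notation C := R[i].
Implicit Types (c tau rho z : C) (N : nat).

(** The common shape of all tiles: centre [c], first vertex [c + tau], and [rho] the rotation to the
    next vertex. *)
Definition polygon c tau rho N : set C :=
  convex_hull [seq c + tau * rho ^+ k | k <- iota 0 N].

Definition root_unity rho N := rho ^+ N = 1 /\ (0 < N)%N.

Lemma expr_mod_unity rho N k : root_unity rho N -> rho ^+ (k %% N) = rho ^+ k.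
Proof. by move=> [rN _]; apply: expr_mod. Qed.

Lemma mem_polygon c tau rho N k : root_unity rho N ->
  c + tau * rho ^+ k \in [seq c + tau * rho ^+ k | k <- iota 0 N].
Proof.
move=> rN; apply/mapP; exists (k %% N)%N; last by rewrite expr_mod_unity.
by rewrite mem_iota add0n ltn_mod rN.2.
Qed.

Lemma polygon_vertex c tau rho N k : root_unity rho N ->
  polygon c tau rho N (c + tau * rho ^+ k).
Proof. by move=> rN; exact/mem_convex_hull/mem_polygon. Qed.

Lemma sub_polygon c tau rho tau' rho' N : root_unity rho' N ->
  (forall k, exists l, tau * rho ^+ k = tau' * rho' ^+ l) ->
  polygon c tau rho N `<=` polygon c tau' rho' N.
Proof.
move=> rN sub; apply: sub_convex_hull => _ /mapP[k _ ->].
by have [l ->] := sub k; exact: mem_polygon.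
Qed.

Lemma polygon_rot c tau rho N m : root_unity rho N ->
  polygon c (tau * rho ^+ m) rho N = polygon c tau rho N.
Proof.
move=> rN; apply/seteqP; split; apply: sub_polygon => // k.
  by exists (m + k)%N; rewrite exprD mulrA.
(* Rotating back by [rho ^+ m] is rotating forward by [rho ^+ (m * N.-1)]. *)
exists (m * N.-1 + k)%N.
rewrite -mulrA -exprD addnA -mulnS prednK ?rN.2 // exprD mulnC exprM rN.1.
by rewrite expr1n mul1r.
Qed.

(** Raising to a power coprime to N permutes the powers of [rho]. This serves for conjugation, which
    replaces the rotation of a tile by such a power. *)
Lemma polygon_inv c tau rho N m : root_unity rho N -> coprime m N ->
  polygon c tau (rho ^+ m) N = polygon c tau rho N.
Proof.
move=> rN mN; have rmN : root_unity (rho ^+ m) N.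
  by split; [rewrite exprAC rN.1 expr1n|exact: rN.2].
apply/seteqP; split; apply: sub_polygon => // k.
  by exists (m * k)%N; rewrite -exprM.
have m0 : (0 < m)%N \/ N = 1%N.
  by case: m mN {rmN} => [|m]; [rewrite /coprime gcd0n => /eqP; right|left].
case: m0 => [m0|N1]; last first.
  by exists 0%N; move: rN; rewrite N1 /root_unity expr1 => -[-> _]; rewrite !expr1n.
(* By Bezout, [km] inverts [m] modulo [N]. *)
case: (egcdnP N m0) => km kn e _.
exists (km * k)%N; rewrite -exprM; congr (_ * _).
rewrite mulnA [(m * km)%N]mulnC e.
move: mN; rewrite /coprime => /eqP ->.
by rewrite mulnDl mul1n exprD mulnC mulnA mulnC !exprM rN.1 !expr1n mul1r.
Qed.

Lemma image_polygon_linear a b c tau rho N :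
  (fun z => a * z + b) @` polygon c tau rho N =
  polygon (a * c + b) (a * tau) rho N.
Proof.
rewrite /polygon affine_convex_hull; last exact: affine_linear.
rewrite -map_comp; congr convex_hull; apply: eq_map => k /=; ring.
Qed.

Lemma image_polygon_antilinear a b c tau rho N :
  (fun z => a * conjc z + b) @` polygon c tau rho N =
  polygon (a * conjc c + b) (a * conjc tau) (conjc rho) N.
Proof.
rewrite /polygon affine_convex_hull; last exact: affine_antilinear.
rewrite -map_comp; congr convex_hull; apply: eq_map => k /=.
by rewrite rmorphD rmorphM rmorphXn /=; ring.
Qed.

Lemma convex_hull_bounded (s : seq C) : exists2 d : R, 0 <= d &
  forall x y, convex_hull s x -> convex_hull s y -> `|x - y| <= d%:C.
Proof.
have [->|s0] := eqVneq s [::].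
  exists 0 => // x y [w [_ + _]]; rewrite big_ord0 => /eqP.
  by rewrite eq_sym oner_eq0.
have [v1 [v2 [_ _ far]]] := farthest_pair s0.
exists (complex.Re `|v1 - v2|); first by rewrite -lecR -norm_realE normr_ge0.
rewrite -norm_realE => x y hx hy; apply: (convex_hull_dist _ hx) => u us.
rewrite distrC; apply: (convex_hull_dist _ hy) => u' us'.
exact: far.
Qed.

(** Iterating a nonzero translation moves [z] arbitrarily far. *)
Lemma bounded_translation (A : set C) (d : R) v z :
  (forall x y, A x -> A y -> `|x - y| <= d%:C) -> A z ->
  (forall x, A x -> A (x + v)) -> v = 0.
Proof.
move=> bd Az tr; apply/eqP; rewrite -normr_eq0; apply/negPn/negP => v0.
have r0 : 0 < complex.Re `|v|.
  by rewrite -ltcR -norm_realE lt_neqAle normr_ge0 eq_sym v0.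
have trn n : A (z + v *+ n).
  by elim: n => [|n IH]; rewrite ?mulr0n ?addr0 // mulrSr addrA; exact: tr.
pose n := Num.bound (d / complex.Re `|v|).
have := bd _ _ (trn n) Az; rewrite addrAC subrr add0r normrMn.
rewrite norm_realE -rmorphMn lecR => h.
have d0 : 0 <= d.
  by have := bd _ _ Az Az; rewrite subrr normr0 lecR.
have := archi_boundP (divr_ge0 d0 (ltW r0)).
by rewrite ltr_pdivrMr // mulr_natl -/n ltNge h.
Qed.

(* Opposite rotations about two distinct centres compose to a translation,   *)
(* which cannot preserve a bounded set.                                      *)
Lemma polygon_center_inj p q tau tau' rho N : root_unity rho N -> rho != 1 ->
  polygon p tau rho N = polygon q tau' rho N -> p = q.
Proof.
move=> rN r1 e.
have rot c t z : polygon c t rho N z ->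
    polygon c t rho N (rho * z + (c - rho * c)).
  move=> hz; have : ((fun z => rho * z + (c - rho * c)) @` polygon c t rho N)
     (rho * z + (c - rho * c)) by exists z.
  rewrite image_polygon_linear (_ : rho * c + _ = c); last by ring.
  by have := @polygon_rot c t rho N 1 rN; rewrite expr1 mulrC => ->.
have rotV c t n z : polygon c t rho N z ->
    polygon c t rho N (rho ^+ n * (z - c) + c).
  move=> hz; elim: n => [|n IH]; first by rewrite expr0 mul1r subrK.
  by have := rot _ _ _ IH; congr polygon; rewrite exprS; ring.
have [d _ bd] := convex_hull_bounded [seq p + tau * rho ^+ k | k <- iota 0 N].
have rr : rho ^+ N.-1 * rho = 1 by rewrite -exprSr prednK ?rN.2 // rN.1.
have v0 : (rho - 1) * (p - q) = 0.
  apply: (@bounded_translation (polygon p tau rho N) d _ (p + tau * rho ^+ 0) bd).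
    exact: polygon_vertex.
  move=> x hx; have := rotV _ _ N.-1 _ hx; rewrite {1}e => /rot.
  rewrite -e; set y := rho * _ + _; have -> // : y = x + (rho - 1) * (p - q).
  rewrite /y mulrDr mulrA [rho * _]mulrC rr; ring.
move/eqP: v0; rewrite mulf_eq0 !subr_eq0 (negbTE r1) /=.
by move/eqP.
Qed.
End Polygon.

(** * The regular tilings *)

Section Tiles.
Variable R : realType.
Local Notation C := R[i].
Local Notation zeta := (1 + omega : C).
Implicit Types (t : regular_tiling) (A : set C) (z u v : C).

Definition lattice t : set C := [set v | exists l r : int, v = lattice_point R t l r].

(** The triangles are centred at the Eisenstein integers outside the ideal (2 + omega), and a + b
    omega lies in that ideal exactly when 3 divides a + b. *)
Definition tile_center t : set C := [set c | exists a b : int,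
  c = a%:~R + b%:~R * xi R t /\ (if t is Triangles then ~~ (3 %| a + b)%Z else true)].

Definition rot_gen t : C :=
  match t with Squares => 'i | Hexagons => zeta | Triangles => omega end.
Definition rot_order t : nat :=
  match t with Squares => 4 | Hexagons => 6 | Triangles => 3 end.

Lemma rot_gen_unity t : root_unity (rot_gen t) (rot_order t).
Proof. by case: t; split=> //=; rewrite ?i4 ?zeta6 ?omega_expr3. Qed.

Lemma rot_gen_neq1 t : rot_gen t != 1.
Proof.
case: t => /=; last exact: omega_neq1.
  by apply/eqP => e; have := i_im R; rewrite e eqxx.
by rewrite -subr_eq0 addrC addKr omega_neq0.
Qed.

Lemma latticeP t v : lattice t v <-> exists a b : int,
  v = a%:~R + b%:~R * xi R t /\ (if t is Triangles then (3 %| a + b)%Z else true).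
Proof.
rewrite /lattice /lattice_point /=; case: t => /=.
- by split=> [[l [r ->]]|[l [r [-> _]]]]; exists l, r; rewrite mulr1.
- by split=> [[l [r ->]]|[l [r [-> _]]]]; exists l, r; rewrite mulr1.
have key (l r : int) : (l%:~R + r%:~R * omega) * (2 + omega) =
    (2 * l - r)%:~R + (l + r)%:~R * omega :> C.
  rewrite !(intrD, rmorphN, intrM) /=.
  transitivity (2 * l%:~R + (l%:~R + 2 * r%:~R) * omega + r%:~R * omega ^+ 2 : C).
    by ring.
  by rewrite omega_sqr; ring.
split=> [[l [r ->]]|[a [b [-> d3]]]].
  exists (2 * l - r), (l + r); rewrite key; split => //; lia.
(* Inverts a = 2 l - r, b = l + r, for which a + b = 3 l. *)
exists (divz (a + b) 3), (b - divz (a + b) 3); rewrite key.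
by congr (_%:~R + _%:~R * _); lia.
Qed.

Lemma P0E : @P0 R = lattice Triangles.
Proof.
apply/seteqP; split=> [_ [_ [a [b ->]] <-]|_ [a [b ->]]].
  by exists a, b; rewrite mulrC.
by exists (a%:~R + b%:~R * omega); [exists a, b|rewrite mulrC].
Qed.

Lemma latticeB t u v : lattice t u -> lattice t v -> lattice t (u - v).
Proof.
move=> [l [r ->]] [l' [r' ->]]; exists (l - l'), (r - r').
rewrite /lattice_point !(intrD, rmorphN) /=; ring.
Qed.

Lemma lattice0 t : lattice t 0.
Proof. by exists 0, 0; rewrite /lattice_point mul0r addr0 mul0r. Qed.

Lemma latticeN t v : lattice t v -> lattice t (- v).
Proof. by move=> h; rewrite -sub0r; apply: latticeB h; exact: lattice0. Qed.

Lemma latticeD t u v : lattice t u -> lattice t v -> lattice t (u + v).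
Proof. by move=> hu /latticeN; rewrite -{2}[v]opprK; exact: latticeB. Qed.

Lemma lattice_intM t v (k : int) : lattice t v -> lattice t (k%:~R * v).
Proof.
move=> [l [r ->]]; exists (k * l), (k * r).
rewrite /lattice_point !intrM; ring.
Qed.

Lemma lattice_Zadjoin t v : lattice t v -> Zadjoin (xi R t) v.
Proof. by move=> /latticeP[a [b [-> _]]]; exists a, b. Qed.

Lemma ZadjoinM_xi t u v :
  Zadjoin (xi R t) u -> Zadjoin (xi R t) v -> Zadjoin (xi R t) (u * v).
Proof. exact: (ZadjoinM (@xi_sqr R t)). Qed.

Lemma Zadjoin_conj_xi t u : Zadjoin (xi R t) u -> Zadjoin (xi R t) (conjc u).
Proof. exact: (Zadjoin_conj (@xi_conj R t)). Qed.

Lemma Zadjoin_unit_gen t k : Zadjoin (xi R t) (unit_gen R t ^+ k).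
Proof.
elim: k => [|k IH]; first by rewrite expr0; exact: (Zadjoin_int _ 1).
rewrite exprS; apply: ZadjoinM_xi => //.
case: t {IH}; first exact: Zadjoin_gen.
all: by exists 1, 1; rewrite mul1r.
Qed.

Lemma norm_unit_gen t k : `|unit_gen R t ^+ k| = 1.
Proof.
rewrite normrX (_ : `|unit_gen R t| = 1) ?expr1n //.
have u n (x : C) : x ^+ n.+1 = 1 -> `|x| = 1.
  by move=> e; apply/eqP; rewrite -(@pexpr_eq1 _ _ n.+1) // -normrX e normr1.
case: t; [apply: (u 3) | apply: (u 5) | apply: (u 5)].
- exact: i4.
- exact: zeta6.
- exact: zeta6.
Qed.

Lemma latticeM t u v : Zadjoin (xi R t) u -> lattice t v -> lattice t (u * v).
Proof.
move=> hu [l [r ->]].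
have [a [b e]] : Zadjoin (xi R t) (u * (l%:~R + r%:~R * xi R t)).
  by apply: ZadjoinM_xi => //; exists l, r.
by exists a, b; rewrite /lattice_point mulrA e.
Qed.

(** The argument of 2 + omega is pi / 6, so conjugation turns it by - pi / 3. In particular the
    ideal (2 + omega) is stable under conjugation. *)
Lemma conj_2omega : conjc (2 + omega : C) = (2 + omega) * zeta ^+ 5.
Proof.
have -> : conjc (2 + omega : C) = 2 + conjc omega.
  by rewrite rmorphD rmorph_nat.
rewrite conj_omega (exprD _ 3 2) zeta3 zeta_sqr.
transitivity (- 2 * omega - omega ^+ 2 : C); last by ring.
by rewrite omega_sqr; ring.
Qed.

Lemma lattice_conj t v : lattice t v -> lattice t (conjc v).
Proof.
have [->|tT] : t = Triangles \/ (if t is Triangles then false else true).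
- by case: t; [right|right|left].
- move=> [l [r ->]]; rewrite /lattice_point [xi R Triangles]/=.
  set u := _ + _ * _.
  have -> : conjc (u * (2 + omega)) = conjc u * zeta ^+ 5 * (2 + omega).
    transitivity (conjc u * conjc (2 + omega)); first exact: rmorphM.
    by rewrite conj_2omega mulrA mulrAC.
  apply: latticeM; last by exists 1, 0; rewrite /lattice_point mul0r addr0 mul1r.
  apply: (ZadjoinM_xi (t := Triangles)).
    by apply: Zadjoin_conj_xi; exists l, r.
  exact: (Zadjoin_unit_gen Triangles).
move=> /lattice_Zadjoin/Zadjoin_conj_xi[a [b ->]]; apply/latticeP.
by exists a, b; split => //; case: (t) tT.
Qed.

(** The centroid is p + (2 + omega) zeta^k (1 + zeta) / 3, and (2 + omega)^2 = 3 zeta with 1 + zeta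
    = 2 + omega. *)
Lemma triangle_polygon p k :
  triangle p k = polygon (p + zeta ^+ k.+1) (zeta ^+ k) omega 3.
Proof.
rewrite /triangle /polygon /= -[X in X ^+ 0]zeta_sqr -[X in _ * X ^+ 1]zeta_sqr
  -[X in _ * X ^+ 2]zeta_sqr.
set z := zeta ^+ k.
have e0 : p + z * zeta + z * (zeta ^+ 2) ^+ 2 = p.
  by rewrite -exprM (exprD _ 3 1) zeta3; ring.
have e1 : p + z * zeta + z * (zeta ^+ 2) ^+ 0 = p + (2 + omega) * z.
  by rewrite expr0; ring.
have e2 : p + z * zeta + z * (zeta ^+ 2) ^+ 1 = p + (2 + omega) * (z * zeta).
  by rewrite expr1; ring.
rewrite !(exprSr zeta k) -/z e0 e1 e2; apply: eq_mem_convex_hull => y.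
by rewrite !inE orbC -orbA.
Qed.

Lemma tiles_polygon t A : tiles t A ->
  exists c tau, tile_center t c /\ A = polygon c tau (rot_gen t) (rot_order t).
Proof.
case: t => /=.
- move=> [c [a [b ->]] <-]; exists (a%:~R + b%:~R * 'i), ((1 + 'i) / 2).
  by split => //; exists a, b.
- move=> [c [a [b ->]] <-]; exists (a%:~R + b%:~R * omega), ((2 + omega) / 3).
  by split => //; exists a, b.
move=> [p [k [+ ->]]]; rewrite P0E => /latticeP[a [b [/= -> ab]]].
rewrite triangle_polygon; eexists; eexists; split; last by [].
have [c [d [e cd]]] := Zadjoin_norm1 (xi_sqr R Triangles) (xi_conj R Triangles)
  (Zadjoin_unit_gen Triangles k.+1) (norm_unit_gen Triangles k.+1).
exists (a + c), (b + d); split; first by rewrite e /= !intrD; ring.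
(* If 3 divided the coordinate sum of the centre, it would divide c + d, and then also the norm c^2
   - c d + d^2 = (c + d)^2 - 3 c d, which is 1. *)
apply/negP => /dvdzP[m em].
move: cd ab => /= cd /dvdzP[m' em'].
have {em em'} [m'' e3] : exists m'', d = 3 * m'' - c by exists (m - m'); lia.
by move: cd; rewrite e3; lia.
Qed.

Lemma tile_center_tile t c : tile_center t c ->
  exists A tau, tiles t A /\ A = polygon c tau (rot_gen t) (rot_order t).
Proof.
case: t => /= -[a [b [-> h]]]; last set c0 := _ + _.
- exists (square (a%:~R + b%:~R * 'i)), ((1 + 'i) / 2).
  by split => //; eexists; [exists a, b|].
- exists (hexagon (a%:~R + b%:~R * omega)), ((2 + omega) / 3).
  by split => //; eexists; [exists a, b|].
(* As a + b is 1 or -1 modulo 3, subtracting 1 = zeta^6 or -1 = zeta^3 from the centre reaches a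
   vertex of the tiling. *)
have [k pk] : exists k, lattice Triangles (c0 - zeta ^+ k.+1).
  have /orP[] : (3 %| a + b + 1)%Z || (3 %| a + b - 1)%Z by lia.
    exists 2; apply/latticeP; exists (a + 1), b; rewrite /c0 zeta3 intrD opprK.
    split; [rewrite /=; ring|by lia].
  exists 5; apply/latticeP; exists (a - 1), b; rewrite /c0 zeta6 rmorphB /=.
  split; [rewrite /=; ring|by lia].
exists (triangle (c0 - zeta ^+ k.+1) k), (zeta ^+ k); split.
  by exists (c0 - zeta ^+ k.+1), k; rewrite P0E.
by rewrite triangle_polygon subrK.
Qed.

End Tiles.

(** * Motions that preserve a regular tiling *)

Section TileMaps.
Variable R : realType.
Local Notation C := R[i].
Local Notation zeta := (1 + omega : C).
Implicit Types (t : regular_tiling) (A : set C) (z u v : C).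

Lemma image_addE v A : (fun z => z + v) @` A = (fun z => 1 * z + v) @` A.
Proof. by congr image; apply/funext => z; rewrite mul1r. Qed.

Lemma tiles_translate t v A : lattice t v -> tiles t A ->
  tiles t ((fun z => z + v) @` A).
Proof.
move=> hv; rewrite image_addE; case: t hv => hv /=.
- move=> [c hc <-]; exists (c + v); first exact: (ZadjoinD hc (lattice_Zadjoin hv)).
  by rewrite -[square c]/(polygon c _ _ 4) image_polygon_linear !mul1r.
- move=> [c hc <-]; exists (c + v); first exact: (ZadjoinD hc (lattice_Zadjoin hv)).
  by rewrite -[hexagon c]/(polygon c _ _ 6) image_polygon_linear !mul1r.
move=> [p [k [hp ->]]]; exists (p + v), k; split.
  by move: hp; rewrite P0E => hp; exact: latticeD.
by rewrite !triangle_polygon image_polygon_linear !mul1r addrAC.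
Qed.

Lemma half_sqrt3i_conj : conjc ((2 + omega : C) / 3) = (2 + omega) / 3 * zeta ^+ 5.
Proof.
transitivity (conjc (2 + omega : C) / conjc 3).
  by rewrite -fmorphV; exact: rmorphM.
by rewrite conj_2omega rmorph_nat mulrAC.
Qed.

Lemma half1i_conj : conjc ((1 + 'i : C) / 2) = (1 + 'i) / 2 * 'i ^+ 3.
Proof.
transitivity ((1 + conjc 'i : C) / conjc 2).
  by rewrite -fmorphV -[X in X + conjc _](conjc1 R) -rmorphD; exact: rmorphM.
have i3 : 'i ^+ 3 = - 'i :> C by rewrite exprS sqrCi mulrN1.
rewrite rmorph_nat i_conj3 i3.
rewrite [RHS](_ : _ = (- 'i - 'i ^+ 2) / 2); last by field.
by rewrite sqrCi; field.
Qed.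

Lemma tiles_antilinear t u A : Zadjoin (xi R t) u -> `|u| = 1 -> tiles t A ->
  tiles t ((fun z => u * conjc z) @` A).
Proof.
move=> hu nu; have [m um] := unit_power hu nu.
have -> : (fun z => u * conjc z) @` A = (fun z => u * conjc z + 0) @` A.
  by congr image; apply/funext => z; rewrite addr0.
case: t hu um => hu um /=.
- move=> [c hc <-]; exists (u * conjc c).
    by apply: (ZadjoinM_xi (t := Squares)) => //;
      exact: (Zadjoin_conj_xi (t := Squares)).
  rewrite -![square _]/(polygon _ ((1 + 'i) / 2) 'i 4).
  rewrite image_polygon_antilinear addr0.
  rewrite i_conj3 polygon_inv //; last exact: (rot_gen_unity R Squares).
  rewrite um half1i_conj mulrCA -exprD polygon_rot //.
  exact: (rot_gen_unity R Squares).
- move=> [c hc <-]; exists (u * conjc c).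
    by apply: (ZadjoinM_xi (t := Hexagons)) => //;
      exact: (Zadjoin_conj_xi (t := Hexagons)).
  rewrite -![hexagon _]/(polygon _ ((2 + omega) / 3) zeta 6).
  rewrite image_polygon_antilinear addr0.
  rewrite zeta_conj polygon_inv //; last exact: (rot_gen_unity R Hexagons).
  rewrite um half_sqrt3i_conj mulrCA -exprD polygon_rot //.
  exact: (rot_gen_unity R Hexagons).
move=> [p [k [hp ->]]]; rewrite P0E in hp.
(* With u = zeta^m, vertex direction zeta^j goes to zeta^(m + 5 + 5 j). Orientation is reversed, so
   the image of direction k + 1 comes first and that of k is the next one modulo 6. *)
exists (u * conjc p), (m + 5 + 5 * k.+1)%N; split.
  rewrite P0E; apply: latticeM => //; exact: lattice_conj.
rewrite /triangle affine_convex_hull; last exact: affine_antilinear.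
have vertex j : u * conjc (p + (2 + omega) * zeta ^+ j) + 0 =
    u * conjc p + (2 + omega) * zeta ^+ (m + 5 + 5 * j).
  transitivity (u * (conjc p + conjc (2 + omega) * conjc zeta ^+ j) + 0).
    by rewrite -rmorphXn -rmorphM -rmorphD.
  by rewrite conj_2omega zeta_conj -exprM um /= !exprD; ring.
apply: eq_mem_convex_hull => y.
rewrite /= !vertex addr0 mulnS.
have -> : zeta ^+ (m + 5 + (5 + 5 * k)).+1 = zeta ^+ (m + 5 + 5 * k).
  by rewrite (_ : (_ + _).+1 = 6 + (m + 5 + 5 * k))%N ?exprD ?zeta6 ?mul1r //; lia.
by rewrite !inE; congr (_ || _); rewrite orbC.
Qed.

End TileMaps.

(** * The tiles cover the plane *)

Section Covering.
Variable R : realType.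
Local Notation C := R[i].
Local Notation zeta := (1 + omega : C).
Implicit Types (t : regular_tiling) (A : set C) (z u v : C).

(** In the basis 1, zeta the point z / sigma has coordinates x - y and y. Their fractional parts p
    and q locate it in a unit rhombus, which the diagonal p + q = 1 cuts into two triangles. *)
Lemma triangular_cell (sigma z : C) : sigma != 0 ->
  exists (a b : int) (e : bool) (r s t : R),
  let q := sigma * (a%:~R + b%:~R * omega) in
  [/\ 0 <= r, 0 <= s, 0 <= t, r + s + t = 1 &
   z = r%:C * q + s%:C * (q + (-1) ^+ e * sigma)
       + t%:C * (q + (-1) ^+ e * sigma * zeta)].
Proof.
move=> s0; have [x [y xy]] := real_coord (Im_omega_neq0 R) (z / sigma).
have zE : z = sigma * (x%:C + y%:C * omega) by rewrite -xy mulrC divfK.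
pose m := Num.floor (x - y); pose n := Num.floor y.
have /andP[m0 m1] := floor_itv (x - y); have /andP[n0 n1] := floor_itv y.
rewrite -/m -/n intrD in m0 m1 n0 n1.
pose p := x - y - m%:~R; pose q := y - n%:~R.
have xE : x = p + q + m%:~R + n%:~R by rewrite /p /q; ring.
have yE : y = q + n%:~R by rewrite /q; ring.
have p0 : 0 <= p by rewrite /p; lra.
have q0 : 0 <= q by rewrite /q; lra.
have p1 : p < 1 by rewrite /p; lra.
have q1 : q < 1 by rewrite /q; lra.
have xC : x%:C = p%:C + q%:C + m%:~R + n%:~R.
  by rewrite xE !rmorphD /= !intrE_complex.
have yC : y%:C = q%:C + n%:~R by rewrite yE rmorphD /= intrE_complex.
clearbody p q.
have [le1|gt1] := lerP (p + q) 1.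
  exists (m + n), n, false, (1 - p - q), p, q => Q; split; [lra|lra|lra|lra|].
  by rewrite /Q zE xC yC !rmorphB rmorph1 /= !intrD expr0; ring.
(* Beyond the diagonal the triangle is based at the far corner (m + 1) + (n + 1) zeta of the
   rhombus. *)
exists (m + n + 2), (n + 1), true, (p + q - 1), (1 - p), (1 - q) => Q.
split; [lra|lra|lra|lra|].
by rewrite /Q zE xC yC !rmorphB rmorphD !rmorph1 /= !intrD expr1; ring.
Qed.

Lemma norm_2omega : (2 + omega) * (1 - omega) = 3 :> C.
Proof.
transitivity (2 - omega - omega ^+ 2 : C); first by ring.
by rewrite omega_sqr; ring.
Qed.

Lemma two_omega_neq0 : 2 + omega != 0 :> C.
Proof.
have : 3 != 0 :> C by rewrite pnatr_eq0.
by rewrite -norm_2omega mulf_eq0 negb_or => /andP[].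
Qed.

Lemma sqr_2omega : (2 + omega) / 3 * (2 + omega) = zeta.
Proof.
transitivity ((4 + 4 * omega + omega ^+ 2) / 3 : C); first by field.
by rewrite omega_sqr; field.
Qed.

Lemma hexagon_mem (c : C) (s := (2 + omega) / 3 : C) :
  [/\ hexagon c c, forall e : bool, hexagon c (c + (-1) ^+ e * s),
      forall e : bool, hexagon c (c + (-1) ^+ e * s * zeta) &
      forall e : bool, hexagon c (c + (-1) ^+ e * s * omega)].
Proof.
have V k : hexagon c (c + s * zeta ^+ k).
  exact: (polygon_vertex c s k (rot_gen_unity R Hexagons)).
have half : 0 <= (2^-1 : R) <= 1 by apply/andP; split; lra.
have sgn (e : bool) : (-1) ^+ e = zeta ^+ (3 * e) :> C by rewrite exprM zeta3.
split=> [|e|e|e].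
- have := convex_hull_convex half (V 0%N) (V 3%N); congr convex_hull.
  rewrite expr0 zeta3 rmorphB rmorph1 fmorphV /= rmorph_nat; by field.
- by rewrite sgn mulrC; exact: V.
- by rewrite sgn -mulrA mulrC -mulrA -exprS; exact: V.
- have -> : (-1) ^+ e * s * omega = s * zeta ^+ (3 * e + 2); last exact: V.
  by rewrite sgn exprD zeta_sqr; ring.
Qed.

Lemma tiles_cover t z : exists2 A, tiles t A & A z.
Proof.
case: t => /=.
- pose a := Num.floor (complex.Re z + 2^-1); pose b := Num.floor (complex.Im z + 2^-1).
  have /andP[a0 a1] := floor_itv (complex.Re z + 2^-1).
  have /andP[b0 b1] := floor_itv (complex.Im z + 2^-1).
  rewrite -/a -/b intrD in a0 a1 b0 b1.
  pose c : C := a%:~R + b%:~R * 'i.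
  exists (square c); first by exists c => //; exists a, b.
  pose x := complex.Re z - a%:~R + 2^-1; pose y := complex.Im z - b%:~R + 2^-1.
  have x01 : 0 <= x <= 1 by rewrite /x; apply/andP; split; lra.
  have y01 : 0 <= y <= 1 by rewrite /y; apply/andP; split; lra.
  have V k := polygon_vertex c ((1 + 'i) / 2) k (rot_gen_unity R Squares).
  (* Interpolate along the top and bottom sides of the square, then vertically between them. *)
  have top := convex_hull_convex x01 (V 1%N) (V 0%N).
  have bot := convex_hull_convex x01 (V 2%N) (V 3%N).
  have := convex_hull_convex y01 bot top; congr convex_hull.
  have xE : complex.Re z = x + a%:~R - 2^-1 by rewrite /x; ring.
  have yE : complex.Im z = y + b%:~R - 2^-1 by rewrite /y; ring.
  rewrite /rot_gen /c expr0 expr1 (exprS _ 2) sqrCi [RHS]complexE complexiE xE yE.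
  have -> : (1 + 'i) / 2 * 'i = ('i - 1) / 2 :> C.
    transitivity (('i + 'i ^+ 2) / 2 : C); first by field.
    by rewrite sqrCi.
  have -> : (1 + 'i) / 2 * ('i * -1) = (1 - 'i) / 2 :> C.
    transitivity (- ('i + 'i ^+ 2) / 2 : C); first by field.
    by rewrite sqrCi; field.
  clearbody x y.
  rewrite !rmorphD !rmorphN !rmorph1 fmorphV /= !rmorph_int rmorph_nat.
  by field.
- set s := (2 + omega) / 3 : C.
  have s0 : s != 0 by rewrite mulf_neq0 ?two_omega_neq0 ?invr_eq0 ?pnatr_eq0.
  have [a [b [e [r1 [r2 [r3 [r10 r20 r30 r123 zE]]]]]]] :=
  triangular_cell z s0.
  set q := s * _ in zE.
  (* Each hexagon consists of six cells of side |s| around its centre. The points s (k + l omega)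
     with 3 | k + l are hexagon centres, because s (2 + omega) = zeta is a unit, and every cell has
     such a vertex. *)
  suff [c hc [V1 V2 V3]] : exists2 c, Zadjoin omega c & [/\ hexagon c q,
      hexagon c (q + (-1) ^+ e * s) & hexagon c (q + (-1) ^+ e * s * zeta)].
    exists (hexagon c); first by exists c.
    by rewrite zE; apply: convex_hull_convex3.
  have centre (k l : int) : (3 %| k + l)%Z ->
      Zadjoin omega (s * (k%:~R + l%:~R * omega)).
    move=> kl; have [m [n mn]] : lattice Triangles (k%:~R + l%:~R * omega : C).
      by apply/latticeP; exists k, l.
    rewrite mn /lattice_point /= mulrCA sqr_2omega.
    apply: (ZadjoinM_xi (t := Hexagons)).
      by exists m, n.
    exact: (Zadjoin_unit_gen R Hexagons 1).
  pose sg : int := if e then -1 else 1.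
  have sgE : (-1) ^+ e = sg%:~R :> C by rewrite /sg; case: (e); rewrite ?expr0 ?expr1.
  have sgN : (-1) ^+ (~~ e) = - sg%:~R :> C.
    by rewrite /sg; case: (e); rewrite ?expr0 ?expr1 ?mulrN1z ?opprK.
  (* The coordinate sums of the three vertices run through all residues modulo 3. *)
  have : [\/ (3 %| a + b)%Z, (3 %| (a + sg) + b)%Z | (3 %| (a + sg) + (b + sg))%Z].
    by apply/or3P; rewrite /sg; case: (e); lia.
  case=> /centre; set c := _ * _ => hc; exists c => //;
      have [h0 h1 hz hw] := hexagon_mem c; split.
  + exact: h0.
  + exact: h1.
  + exact: hz.
  + rewrite (_ : q = c + (-1) ^+ (~~ e) * s) //.
    by rewrite sgN /c /q intrD; ring.
  + by rewrite sgE (_ : _ + _ = c) // /c /q intrD; ring.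
  + rewrite (_ : _ + _ = c + (-1) ^+ e * s * omega) //.
    by rewrite sgE /c /q intrD; ring.
  + rewrite (_ : q = c + (-1) ^+ (~~ e) * s * zeta) //.
    by rewrite sgN /c /q !intrD; ring.
  + rewrite (_ : _ + _ = c + (-1) ^+ (~~ e) * s * omega) //.
    by rewrite sgE sgN /c /q !intrD; ring.
  + by rewrite sgE (_ : _ + _ = c) // /c /q !intrD; ring.
have [a [b [e [r1 [r2 [r3 [r10 r20 r30 r123 zE]]]]]]] :=
  triangular_cell z two_omega_neq0.
(* At the scale 2 + omega the cells are the tiles themselves, with (-1)^e = zeta^(3 e). *)
exists (triangle ((2 + omega) * (a%:~R + b%:~R * omega)) (3 * e)).
  eexists; eexists; split; last by [].
  by exists (a%:~R + b%:~R * omega) => //; exists a, b.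
rewrite zE; apply: convex_hull_convex3 => //; apply: mem_convex_hull.
- by rewrite inE eqxx.
- by rewrite exprM zeta3 [_ * (2 + omega)]mulrC !inE eqxx orbT.
- by rewrite exprSr exprM zeta3 [_ * (2 + omega)]mulrC mulrA !inE eqxx !orbT.
Qed.
End Covering.

(** * Rigidity *)

Section Rigidity.
Variable R : realType.
Local Notation C := R[i].
Local Notation zeta := (1 + omega : C).
Implicit Types (t : regular_tiling) (A : set C) (z u v : C).

Lemma conj_rot_gen t : exists2 m, coprime m (rot_order t) &
  conjc (rot_gen R t) = rot_gen R t ^+ m.
Proof.
case: t.
- by exists 3%N => //; exact: i_conj3.
- by exists 5%N => //; exact: zeta_conj.
- by exists 2%N => //; rewrite [LHS]conj_omega omega_sqr.
Qed.

Definition id_or_conj (J : C -> C) := J = id \/ J = conjc.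

Lemma image_tile_polygon t J u v c tau : id_or_conj J ->
  exists tau', (fun z => u * J z + v) @` polygon c tau (rot_gen R t) (rot_order t)
    = polygon (u * J c + v) tau' (rot_gen R t) (rot_order t).
Proof.
case=> ->; first by exists (u * tau); rewrite image_polygon_linear.
exists (u * conjc tau); rewrite image_polygon_antilinear.
have [m cm ->] := conj_rot_gen t.
by rewrite polygon_inv //; exact: rot_gen_unity.
Qed.

(** The image polygon has the image of the centre as a centre, and [polygon_center_inj] makes the
    centre unique. *)
Lemma tile_center_image t J u v : id_or_conj J ->
  (forall A, tiles t A -> tiles t ((fun z => u * J z + v) @` A)) ->
  forall c, tile_center t c -> tile_center t (u * J c + v).
Proof.
move=> hJ ft c /tile_center_tile[A [tau [tA AE]]].
have := ft _ tA; rewrite AE; have [tau' ->] := image_tile_polygon t u v c tau hJ.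
move=> /tiles_polygon[c' [tau'' [hc' e]]].
by rewrite (polygon_center_inj (rot_gen_unity R t) (rot_gen_neq1 R t) e).
Qed.

(** The linear part u is the difference of the images of two centres that differ by 1. For squares
    and hexagons 0 is a centre, and v is its image. For triangles 0 is a vertex: there v + u and v -
    u, the images of the centres 1 and -1, have coordinate sums prime to 3, as has the unit u;
    modulo 3 this forces the sum for v to vanish. *)
Lemma rigid_motion t J u v : id_or_conj J -> `|u| = 1 ->
  (forall A, tiles t A -> tiles t ((fun z => u * J z + v) @` A)) ->
  Zadjoin (xi R t) u /\ lattice t v.
Proof.
move=> hJ nu ft; have fc := tile_center_image hJ ft.
have J0 : J 0 = 0 by case: hJ => ->; rewrite ?conjc0.
have J1 : J 1 = 1 by case: hJ => ->; rewrite ?conjc1.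
have JN z : J (- z) = - J z by case: hJ => -> //; exact: rmorphN.
have JB x y : J (x - y) = J x - J y by case: hJ => -> //; exact: rmorphB.
have [tT|tT] : t = Triangles \/ t <> Triangles by case: t {ft fc}; [right|right|left].
  subst t.
  have center (a b : int) (p : ~~ (3 %| a + b)%Z) :
    tile_center Triangles (a%:~R + b%:~R * omega : C) by exists a, b.
  have hu : Zadjoin (omega : C) u.
    have [a [b [e1 _]]] := fc _ (center 1 1 isT).
    have [a' [b' [e2 _]]] := fc _ (center 0 1 isT).
    rewrite (_ : u = (u * J (1%:~R + 1%:~R * omega) + v)
      - (u * J (0%:~R + 1%:~R * omega) + v)); last first.
      by rewrite opprD addrACA subrr addr0 -mulrBr -JB add0r addrK J1 mulr1.
    by rewrite e1 e2; apply: ZadjoinB; [exists a, b|exists a', b'].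
  have [c [d [ue cd]]] :=
    Zadjoin_norm1 (xi_sqr R Triangles) (xi_conj R Triangles) hu nu.
  split=> //; have [a [b [e1 ab]]] := fc _ (center 1 0 isT).
  have [a' [b' [e2 ab']]] := fc _ (center (-1) 0 isT).
  move: e1 e2; rewrite !mul0r !addr0 mulrN1z JN J1 mulrN mulr1 => e1 e2.
  have vE : v = (a - c)%:~R + (b - d)%:~R * xi R Triangles.
    transitivity (u + v - u); first by ring.
    by rewrite e1 ue !intrB; ring.
  apply/latticeP; exists (a - c), (b - d); split => //.
  have [a'E b'E] : a' = a - 2 * c /\ b' = b - 2 * d.
    apply: (int_coord_inj (xi_im R Triangles)).
    rewrite -e2 !(intrD, rmorphN, intrM) /=.
    transitivity (u + v - 2 * u); first by ring.
    by rewrite e1 ue /=; ring.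
  move: cd ab ab' => /= cd.
  have : ~ (3 %| c + d)%Z.
    move=> /dvdzP[m em]; have e3 : d = 3 * m - c by lia.
    by move: cd; rewrite e3; lia.
  move=> /negP cd3 ab3; rewrite a'E b'E.
  have : (3 %| a + b - (c + d))%Z || (3 %| a + b + (c + d))%Z by lia.
  by lia.
have center (a : int) : tile_center t (a%:~R : C).
  by exists a, 0; rewrite mul0r addr0; split => //; case: (t) tT.
have [a [b [e0 _]]] := fc _ (center 0); have [a' [b' [e1 _]]] := fc _ (center 1).
rewrite mulr0z J0 mulr0 add0r in e0; rewrite J1 mulr1 in e1.
split; last by apply/latticeP; exists a, b; split => //; case: (t) tT.
have -> : u = (a'%:~R + b'%:~R * xi R t) - (a%:~R + b%:~R * xi R t).
  by rewrite -e1 -e0 addrK.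
by apply: ZadjoinB; [exists a', b'|exists a, b].
Qed.

End Rigidity.

(** * Lifting symmetries of the spiral tiling *)

Section SpiralSymmetries.
Variable R : realType.
Local Notation C := R[i].
Variables (t : regular_tiling) (alpha : C).
Hypothesis adm : admissible t alpha.
Hypothesis alpha_lattice : lattice t alpha.
Implicit Types (g : plane_isometry R) (A B : set C) (z u v : C) (J : C -> C).

Let alpha0 : alpha != 0. Proof. by case: adm. Qed.

Lemma tile_hull A : tiles t A -> exists s : seq C, A = convex_hull s.
Proof. by move=> /tiles_polygon[c [tau [_ ->]]]; eexists. Qed.

Lemma tile_nonempty A : tiles t A -> A !=set0.
Proof.
move=> /tiles_polygon[c [tau [_ ->]]]; exists (c + tau * rot_gen R t ^+ 0).
exact/polygon_vertex/rot_gen_unity.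
Qed.

Lemma tile_diameter : exists m : C, [/\ 0 <= m, m < `|alpha| &
  forall A, tiles t A -> forall x y, A x -> A y -> `|x - y| <= m].
Proof.
case: adm => _ _ [m [[A [z1 [z2 [_ _ _ mE]]]] ub lt]]; exists m.
have m0 : 0 <= m by rewrite mE normr_ge0.
split=> // {mE z1 z2}B tB; have [s BE] := tile_hull tB; rewrite BE.
apply: convex_hull_diameter => // x y bx by_; apply: ub.
rewrite -BE in bx by_; exists B, x, y; split.
- exact: tB.
- exact: bx.
- exact: by_.
- exact: erefl.
Qed.

Definition preserves_tiles (f : C -> C) := forall A, tiles t A -> tiles t (f @` A).

Lemma id_or_conj_affine J u v : id_or_conj J -> affine (fun z => u * J z + v).
Proof. by case=> ->; [exact: affine_linear|exact: affine_antilinear]. Qed.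

Lemma id_or_conj_dist J u v x y : id_or_conj J -> `|u| = 1 ->
  `|(u * J x + v) - (u * J y + v)| = `|x - y|.
Proof.
move=> hJ u1; rewrite opprD addrACA subrr addr0 -mulrBr normrM u1 mul1r.
by case: hJ => ->; rewrite // -rmorphB; exact: normcJ.
Qed.

Lemma convex_hull_convex_set (s : seq C) : convex_set (convex_hull s).
Proof. by move=> x y k; exact: convex_hull_convex. Qed.

(** The moved tile and some tile [B] have the same image under [phi alpha], so they differ by a
    multiple of alpha, which is a lattice vector. *)
Lemma lift_preserves_tiles g J u v : id_or_conj J -> `|u| = 1 ->
  (forall z, g (phi alpha z) = phi alpha (u * J z + v)) ->
  symmetries (spiral_tiling t alpha) g ->
  preserves_tiles (fun z => u * J z + v).
Proof.
move=> hJ u1 gf /symmetriesP[gS _] A tA; set f := fun z => _.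
have [B tB AB] : spiral_tiling t alpha (phi alpha @` (f @` A)).
  have /gS : spiral_tiling t alpha (phi alpha @` A) by exists A.
  rewrite !image_comp; congr (spiral_tiling _ _ (_ @` _)).
  by apply/funext => z /=; rewrite gf.
have [m [m0 ma diam]] := tile_diameter.
have [d d01 wd] := diameter_width alpha0 m0 ma.
have [sA AE] := tile_hull tA; have [sB BE] := tile_hull tB.
have fAE : f @` A = convex_hull (map f sA).
  by rewrite AE affine_convex_hull //; exact: id_or_conj_affine.
have [k ->] : exists k : int, f @` A = [set z + k%:~R * alpha | z in B].
  apply: (phi_image_eq alpha0 d01) => //.
  - by rewrite fAE; exact: convex_hull_convex_set.
  - by rewrite BE; exact: convex_hull_convex_set.
  - by have [x Ax] := tile_nonempty tA; exists (f x), x.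
  - exact: tile_nonempty.
  - apply: wd => _ _ [x Ax <-] [y Ay <-]; rewrite id_or_conj_dist //.
    exact: diam tA _ _ Ax Ay.
  - exact/wd/diam.
by apply: tiles_translate => //; exact: lattice_intM.
Qed.

Lemma descend_preserves_spiral g f : (forall z, g (phi alpha z) = phi alpha (f z)) ->
  preserves_tiles f ->
  forall A, spiral_tiling t alpha A -> spiral_tiling t alpha (g @` A).
Proof.
move=> gf ft _ [A tA <-]; exists (f @` A); first exact: ft.
by rewrite !image_comp; congr (_ @` _); apply/funext => z /=; rewrite gf.
Qed.

(** If [g 0] were nonzero, it would lie in a tile, whose preimage under [g] is a tile containing 0;
    but [phi alpha] omits 0. *)
Lemma symmetry_fix0 g : symmetries (spiral_tiling t alpha) g -> g 0 = 0.
Proof.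
move=> /symmetriesP[_ gS]; apply/eqP/negPn/negP => /(phi_surj alpha0)[z zE].
have [A tA Az] := tiles_cover t z.
have [B tB BE] := gS _ (ex_intro2 _ _ A tA erefl).
have : ((g^-1)%g @` (phi alpha @` A)) 0.
  exists (phi alpha z); first by exists z.
  by rewrite zE isometry_invE.
rewrite -BE => -[y _ y0]; have := phi_neq0 alpha y.
by rewrite y0 eqxx.
Qed.

Lemma conj_ratio_norm : `|alpha / conjc alpha| = 1.
Proof. by rewrite normrM normfV normcJ divff // normr_eq0. Qed.

Lemma symmetry_cases g : symmetries (spiral_tiling t alpha) g ->
  exists v (s : R), [/\ lattice t v, v = s%:C * alpha &
   (forall z, g z = phi alpha v * z) \/
   ((forall z, g z = phi alpha v * conjc z) /\
     Zadjoin (xi R t) (- (alpha / conjc alpha)))].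
Proof.
move=> gS; have [u u1 gu] := isometry_fix0 (symmetry_fix0 gS).
have [v vE] : exists v, phi alpha v = u.
  by apply: (phi_surj alpha0); rewrite -normr_eq0 u1 oner_eq0.
have [s sE] : exists s : R, v = s%:C * alpha.
  by apply: (norm_phi_eq1 alpha0); rewrite vE.
exists v, s; rewrite vE; case: gu => gu.
  have h : id_or_conj (id : C -> C) by left.
  have [] := rigid_motion h (normr1 _)
      (lift_preserves_tiles h (normr1 _) _ gS (v := v)).
    by move=> z; rewrite gu mul1r phiD vE mulrC.
  by split=> //; left.
have h : id_or_conj (@conjc R) by right.
have n1 : `|- (alpha / conjc alpha)| = 1 by rewrite normrN conj_ratio_norm.
have [] := rigid_motion h n1 (lift_preserves_tiles h n1 _ gS (v := v)).
  by move=> z; rewrite gu conj_phi // phiD vE mulrC.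
by split=> //; right.
Qed.

(** This expresses balancedness through the linear part of the lift of conjugation. The ratio alpha
    / conj alpha has modulus 1, so its inverse is its conjugate, and membership in Z[xi] already
    makes it a unit. *)
Lemma balancedE : balanced t alpha <-> Zadjoin (xi R t) (- (alpha / conjc alpha)).
Proof.
have c0 : conjc alpha != 0 by rewrite conjc_eq0.
split=> [[_ [u [v [hu hv uv e]]]]|h].
  apply: ZadjoinN; suff -> : alpha / conjc alpha = v by [].
  apply: (mulIf c0); rewrite divfK // e mulrA [v * u]mulrC uv mul1r //.
split; first exact: lattice_Zadjoin.
have {}h := ZadjoinN h; rewrite opprK in h.
exists (conjc alpha / alpha), (alpha / conjc alpha); split=> //.
- have := Zadjoin_conj_xi h; congr Zadjoin.
  transitivity (conjc alpha / conjc (conjc alpha)); last by rewrite conjcK.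
  rewrite -[(conjc (conjc alpha))^-1]fmorphV; exact: rmorphM.
- by field; apply/andP.
- by rewrite divfK.
Qed.

End SpiralSymmetries.

(** * The symmetry groups *)

Section RotationGroup.
Variable R : realType.
Local Notation C := R[i].
Variable n : nat.
Hypothesis n_gt0 : (0 < n)%N.
Implicit Types (z : C) (i j k : nat).

Definition root1 : C := cexp (2 * pi%:C * 'i / n%:R).

Local Notation w := root1.
Local Notation rho := (g1 R n : plane_isometry R).
Local Notation tau := (g2 : plane_isometry R).

Lemma n_neq0 : n%:R != 0 :> C. Proof. by rewrite pnatr_eq0 -lt0n. Qed.

Lemma root1X k : w ^+ k = cexp (2 * pi%:C * 'i * (k%:R / n%:R)).
Proof. by rewrite -cexpMn -[_ *+ k]mulr_natr mulrAC mulrA. Qed.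

Lemma root1_eq1 k : w ^+ k = 1 <-> (n %| k)%N.
Proof.
have nn := n_neq0.
rewrite root1X cexp_eq1; split=> [[m /(mulfI (twopi_neq0 R)) e]|/dvdnP[m ->]].
  have : (k%:Z)%:~R = (m * n%:Z)%:~R :> C.
    by rewrite intrM -!pmulrn -e divfK.
  move=> /intr_inj km; have : (n%:Z %| k%:Z)%Z by apply/dvdzP; exists m.
  by [].
by exists m%:Z; rewrite natrM mulfK // -pmulrn.
Qed.

Lemma root1_neq0 : w != 0.
Proof.
apply/eqP => e; have /root1_eq1 : (n %| n)%N by [].
by rewrite e expr0n gtn_eqF //= => /eqP; rewrite eq_sym oner_eq0.
Qed.

Lemma root1_inj i j : (i < n)%N -> (j < n)%N -> w ^+ i = w ^+ j -> i = j.
Proof.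
wlog le_ij : i j / (i <= j)%N.
  move=> h li lj e; case: (leqP i j) => [|/ltnW] le; first exact: h.
  by apply/esym/h.
move=> li lj; rewrite -(subnK le_ij) exprD -[LHS]mul1r.
move=> /(mulIf (expf_neq0 _ root1_neq0))/esym/root1_eq1 dvd.
have : (j - i)%N = 0%N.
  apply/eqP; rewrite -leqn0 leqNgt; apply/negP => lt0.
  have := dvdn_leq lt0 dvd; lia.
by lia.
Qed.

Lemma g1XE k z : (rho ^+ k)%g z = w ^+ k * z.
Proof.
elim: k z => [|k IH] z; first by rewrite expg0 expr0 mul1r.
by rewrite expgS isometry_mulE IH /= /rot_fun exprS mulrA.
Qed.

Lemma g1X_mod k : (rho ^+ (k %% n))%g = (rho ^+ k)%g.
Proof.
apply: isometry_eq => z; rewrite !g1XE; congr (_ * _).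
by apply: expr_mod; apply/root1_eq1.
Qed.

Lemma g2_sqr : (tau * tau)%g = 1%g.
Proof. by apply: isometry_eq => z; rewrite isometry_mulE /= conjcK. Qed.

Lemma conj_root1 : w * conjc w = 1.
Proof.
rewrite /root1 conj_cexp -cexpD; apply/cexp_eq1; exists 0; rewrite mulr0.
have -> : 2 * pi%:C * 'i / n%:R = 0 +i* (pi *+ 2 / n%:R) :> C.
  rewrite twopiE -(rmorph_nat (real_complex R)) -fmorphV mulcE !mul0r mulr0.
  by rewrite subrr add0r.
by apply/eqP; rewrite eq_complex /= addr0 subrr !eqxx.
Qed.

Lemma g2_g1X k : (tau * rho ^+ k)%g = ((rho ^+ k)^-1 * tau)%g.
Proof.
suff e : (rho ^+ k * (tau * rho ^+ k))%g = tau by rewrite -[in RHS]e mulKg.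
apply: isometry_eq => z; rewrite !isometry_mulE !g1XE /=.
transitivity (w ^+ k * (conjc w ^+ k * conjc z)).
  by rewrite -rmorphXn -rmorphM.
by rewrite mulrA -exprMn conj_root1 expr1n mul1r.
Qed.

Definition cyclic_map (x : cyclic_group n) : plane_isometry R :=
  (rho ^+ nat_of_ord x)%g.

Lemma cyclic_mapM : {morph cyclic_map : x y / (x * y)%g}.
Proof.
move=> x y; rewrite /cyclic_map -expgnDr.
have -> : nat_of_ord (x * y)%g = ((x + y) %% n.-1.+1)%N by [].
rewrite (_ : _ %% _ = (x + y) %% n)%N; first exact: g1X_mod.
by congr (_ %% _)%N; exact: prednK.
Qed.

Lemma cyclic_ltn (x : 'I_n.-1.+1) : (x < n)%N.
Proof. by rewrite -[X in (_ < X)%N](prednK n_gt0). Qed.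

Lemma cyclic_map_inj : injective cyclic_map.
Proof.
move=> x y e; apply/val_inj/root1_inj; try exact: cyclic_ltn.
by have := congr1 (fun f : plane_isometry R => f 1) e; rewrite !g1XE !mulr1.
Qed.

Lemma cyclic_map_range k : range cyclic_map (rho ^+ k)%g.
Proof.
have lt : (k %% n < n.-1.+1)%N by rewrite prednK // ltn_mod.
by exists (Ordinal lt) => //; exact: g1X_mod.
Qed.

Definition dihedral_map (x : dihedral_group n) : plane_isometry R :=
  (cyclic_map x.1 * tau ^+ nat_of_bool x.2)%g.

Lemma cyclic_mapN (x : 'I_n.-1.+1) : cyclic_map (- x) = (cyclic_map x)^-1%g.
Proof.
apply: (mulgI (cyclic_map x)); rewrite mulgV -cyclic_mapM.
by rewrite -[(_ * _)%g]/(x - x) subrr /cyclic_map expg0.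
Qed.

Lemma dihedral_mapM : {morph dihedral_map : x y / (x * y)%g}.
Proof.
move=> [a s] [b t]; rewrite /dihedral_map.
transitivity (cyclic_map ((a : cyclic_group n) * (if s then - b else b))%g
  * tau ^+ nat_of_bool (s (+) t))%g; first by [].
rewrite cyclic_mapM /= -!mulgA; congr (_ * _)%g.
case: s => /=; last by rewrite expg0 mul1g.
rewrite cyclic_mapN expg1 [(tau * _)%g]mulgA g2_g1X -mulgA; congr (_ * _)%g.
by case: t; rewrite /= ?expg0 ?expg1 ?mulg1 ?g2_sqr.
Qed.

(** Conjugation fixes 1, so the value at 1 determines the rotation; the value at i then detects the
    reflection. *)
Lemma dihedral_map_inj : injective dihedral_map.
Proof.
move=> [a s] [b t] e.
have eE z := congr1 (fun f : plane_isometry R => f z) e.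
have mapE (c : 'I_n.-1.+1) (q : bool) z :
    dihedral_map (c, q) z = w ^+ c * (if q then conjc z else z).
  by rewrite /dihedral_map isometry_mulE g1XE; case: q; rewrite ?expg1 ?expg0.
have ab : a = b.
  apply/val_inj/root1_inj; try exact: cyclic_ltn.
  by have := eE 1; rewrite !mapE !conjc1 !if_same !mulr1.
have := eE 'i%C; rewrite !mapE ab => /(mulfI (expf_neq0 _ root1_neq0)).
have conj_i : conjc 'i%C <> 'i%C :> C by move=> -[] h; clear -h; lra.
by case: (s) (t) => -[] // /esym.
Qed.

Lemma dihedral_map_range k (s : bool) :
  range dihedral_map (rho ^+ k * tau ^+ s)%g.
Proof.
have [x _ xE] := cyclic_map_range k.
by exists (x, s); rewrite // /dihedral_map /= xE.
Qed.

Lemma range_cyclic_map_sub H : is_subgroup H -> H rho -> range cyclic_map `<=` H.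
Proof. by move=> sH Hr _ [x _ <-]; exact: subgroupX. Qed.

Lemma range_dihedral_map_sub H : is_subgroup H -> H rho -> H tau ->
  range dihedral_map `<=` H.
Proof.
move=> sH Hr Ht _ [x _ <-]; apply: subgroupM => //; exact: subgroupX.
Qed.

End RotationGroup.

(** * Lattice vectors along alpha and the generators *)

Section Theorem6.
Variable R : realType.
Local Notation C := R[i].
Variables (t : regular_tiling) (alpha : C) (l r : int) (n : nat).
Hypotheses (adm : admissible t alpha) (alphaE : alpha = lattice_point R t l r)
  (nE : n = gcdn `|l|%N `|r|%N).

Let alpha0 : alpha != 0. Proof. by case: adm. Qed.
Let alpha_lattice : lattice t alpha. Proof. by exists l, r. Qed.

Lemma gcd_gt0 : (0 < n)%N.
Proof.
rewrite nE gcdn_gt0 !absz_gt0 -negb_and; apply/negP => /andP[/eqP l0 /eqP r0].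
by move: alpha0; rewrite alphaE l0 r0 /lattice_point mul0r addr0 mul0r eqxx.
Qed.

Let n0 : n%:R != 0 :> C. Proof. exact/n_neq0/gcd_gt0. Qed.

Lemma lattice_div_gcd : lattice t (alpha / n%:R).
Proof.
have [a la] : exists a : int, l = a * n%:Z.
  by apply/dvdzP; rewrite dvdzE nE /= dvdn_gcdl.
have [b rb] : exists b : int, r = b * n%:Z.
  by apply/dvdzP; rewrite dvdzE nE /= dvdn_gcdr.
exists a, b; rewrite alphaE la rb /lattice_point !intrM -!pmulrn.
by field.
Qed.

Lemma phi_div_gcd k : phi alpha (alpha * (k%:R / n%:R)) = root1 R n ^+ k.
Proof. by rewrite root1X ?gcd_gt0 // /phi mulrCA [alpha * _]mulrC mulrA mulfK. Qed.

(** Let v = s alpha have integer coordinates a = s l, b = s r. Bezout's u l + u' r = n gives s n = u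
    a + u' b, an integer, so v is a multiple of alpha / n. *)
Lemma lattice_line v (s : R) : lattice t v -> v = s%:C * alpha ->
  exists k, phi alpha v = root1 R n ^+ k.
Proof.
move=> [a [b vE]] vs.
have [F F0 FE] : exists2 F : C, F != 0 &
    forall i j, lattice_point R t i j = (i%:~R + j%:~R * xi R t) * F.
  exists (if t is Triangles then 2 + omega else 1) => //.
  by case: t; rewrite ?oner_eq0 ?two_omega_neq0.
have : a%:~R - s * l%:~R = 0 /\ b%:~R - s * r%:~R = 0 :> R.
  apply: (real_coord_eq0 (xi_im R t)); apply: (mulIf F0); rewrite mul0r.
  apply/eqP; rewrite !rmorphB !rmorphM /= -!intrE_complex.
  move/eqP: vs; rewrite vE alphaE !FE -subr_eq0 => /eqP e.
  by apply/eqP; rewrite -e; ring.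
move=> [/eqP + /eqP]; rewrite !subr_eq0 => /eqP ea /eqP eb.
have [u [u' uu']] := Bezoutz l r.
have gE : gcdz l r = n%:Z by rewrite nE.
pose k := u * a + u' * b.
have sk : s * n%:R = k%:~R.
  rewrite /k intrD !intrM ea eb; transitivity (s * (u * l + u' * r)%:~R).
    by rewrite uu' gE.
  by rewrite intrD !intrM; ring.
(* [k] may be negative; adding |k| n makes the exponent a natural number and moves v by |k| alpha,
   which [phi alpha] does not see. *)
have [N NE] : exists N : nat, k + `|k|%N%:Z * n%:Z = N%:Z.
  have k_ge0 : 0 <= k + `|k|%N%:Z * n%:Z by have := gcd_gt0; clearbody k; nia.
  by move: k_ge0; case: (k + _) => // N _; exists N.
exists N; rewrite -phi_div_gcd; apply/phi_eq => //; exists (- `|k|%N%:Z).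
have sE : s%:C = k%:~R / n%:R.
  apply: (mulIf n0); rewrite divfK // intrE_complex -sk rmorphM /=.
  by rewrite (rmorph_nat (real_complex R)).
have -> : N%:R = (k + `|k|%N%:Z * n%:Z)%:~R :> C by rewrite NE.
rewrite vs sE; move: (`|k|%N%:Z) => K; clearbody k.
by rewrite intrD intrM mulrNz -[n%:~R]pmulrn; field.
Qed.

(** The rotation lifts to translation by alpha / n, a lattice vector. *)
Lemma symmetry_g1 : symmetries (spiral_tiling t alpha) (g1 R n).
Proof.
have g1E z : g1 R n (phi alpha z) = phi alpha (z + alpha / n%:R).
  have := phi_div_gcd 1; rewrite expr1 mul1r => e.
  by rewrite phiD e mulrC.
have g1VE z : ((g1 R n)^-1)%g (phi alpha z) = phi alpha (z - alpha / n%:R).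
  by rewrite -[in LHS](subrK (alpha / n%:R) z) -g1E isometry_invE.
apply/symmetriesP; split; apply: descend_preserves_spiral.
- exact: g1E.
- by move=> A; apply: tiles_translate; exact: lattice_div_gcd.
- exact: g1VE.
- by move=> A; apply: tiles_translate; apply/latticeN/lattice_div_gcd.
Qed.

Lemma symmetry_g2 : balanced t alpha -> symmetries (spiral_tiling t alpha) g2.
Proof.
move=> /(balancedE adm alpha_lattice) bal.
have g2V : (g2^-1)%g = g2 :> plane_isometry R.
  by apply: (mulgI g2); rewrite mulgV g2_sqr.
have g2S A : spiral_tiling t alpha A -> spiral_tiling t alpha (g2 @` A).
  apply: (descend_preserves_spiral (g := g2)
    (f := fun z => - (alpha / conjc alpha) * conjc z) (conj_phi alpha0)) => B.
  by apply: tiles_antilinear; rewrite // normrN (conj_ratio_norm adm).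
by apply/symmetriesP; rewrite g2V.
Qed.

Lemma symmetry_form g : symmetries (spiral_tiling t alpha) g ->
  exists k, g = (g1 R n ^+ k)%g \/ (g = (g1 R n ^+ k * g2)%g /\ balanced t alpha).
Proof.
move=> /(symmetry_cases adm alpha_lattice)[v [s [lv vs h]]].
have [k kE] := lattice_line lv vs; exists k; rewrite kE in h.
case: h => [h|[h bal]]; [left|right].
  by apply: isometry_eq => z; rewrite h g1XE.
split; last exact/(balancedE adm alpha_lattice).
by apply: isometry_eq => z; rewrite h isometry_mulE g1XE.
Qed.

End Theorem6.

Theorem theorem6 (R : realType) (t : regular_tiling) (alpha : R[i])
    (l r : int) (n : nat) :
  admissible t alpha ->
  alpha = lattice_point R t l r ->
  n = gcdn `|l|%N `|r|%N ->
  (~ balanced t alpha ->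
     symmetries (spiral_tiling t alpha) = subgroup_generated [set g1 R n] /\
     isomorphic_to (subgroup_generated [set g1 R n]) (cyclic_group n)) /\
  (balanced t alpha ->
     symmetries (spiral_tiling t alpha) = subgroup_generated [set g1 R n; g2] /\
     isomorphic_to (subgroup_generated [set g1 R n; g2]) (dihedral_group n)).
Proof.
move=> adm alphaE nE; have n_gt0 := gcd_gt0 adm alphaE nE.
(* For the symmetries [S], the generated subgroup [H] and the range [K] of the explicit map, a cycle
   of inclusions proves at once the equality of groups and the surjectivity needed for the
   isomorphism. *)
have squeeze (S H K : set (plane_isometry R)) :
    H `<=` S -> S `<=` K -> K `<=` H -> S = H /\ K = H.
  move=> HS SK KH; split; apply/seteqP; split=> // x.
    by move=> /SK/KH.
  by move=> /HS/SK.
have S1 := symmetry_g1 adm alphaE nE.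
have form := symmetry_form adm alphaE nE.
have sS := symmetries_subgroup (spiral_tiling t alpha).
split=> [nbal|bal].
  set H := subgroup_generated _.
  have [SH KH] : symmetries (spiral_tiling t alpha) = H /\
      range (@cyclic_map R n) = H.
    apply: squeeze.
    - by apply: subgroup_generated_sub => // _ ->.
    - by move=> g /form[k [->|[_ /nbal]//]]; exact: cyclic_map_range.
    - apply: range_cyclic_map_sub; first exact: subgroup_generated_subgroup.
      exact: sub_subgroup_generated.
  split=> //; exists (@cyclic_map R n); split=> //.
    exact: cyclic_mapM.
  exact: cyclic_map_inj.
set H := subgroup_generated _.
have [SH KH] : symmetries (spiral_tiling t alpha) = H /\
    range (@dihedral_map R n) = H.
  apply: squeeze.
  - apply: subgroup_generated_sub => // _ [->|->] //.
    exact: (symmetry_g2 adm alphaE bal).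
  - move=> g /form[k [->|[-> _]]].
      by have := dihedral_map_range R n_gt0 k false; rewrite expg0 mulg1.
    by have := dihedral_map_range R n_gt0 k true; rewrite expg1.
  - apply: range_dihedral_map_sub; first exact: subgroup_generated_subgroup.
      by apply: sub_subgroup_generated; left.
    by apply: sub_subgroup_generated; right.
split=> //; exists (@dihedral_map R n); split=> //.
  exact: dihedral_mapM.
exact: dihedral_map_inj.
Qed.
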